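(* If Thompson's group $F$ is amenable, then the reduced C*-algebra $C^*_r(T)$ of Thompson's group $T$ has infinitely many ideals.
   Context: Thompson's group $T$ is the (discrete) group of homeomorphisms of $\mathbb{R}/\mathbb{Z}$ that are piecewise linear, with finitely many breakpoints, all at points of $\Omega=[0,1)\cap\mathbb{Z}[1/2]$, with slopes in $2^{\mathbb{Z}}$, and that map dyadic rationals to dyadic rationals. Thompson's group $F$ is the stabilizer of $0$ in $T$. ''Ideal'' means closed two-sided ideal. *)

(* Defs.v *)
From HB Require Import structures.
From mathcomp Require Import all_boot all_order all_algebra.
From mathcomp Require Import all_classical all_reals all_analysis.
From mathcomp Require Import complex ring lra.

Set Implicit Arguments.
Unset Strict Implicit.
Unset Printing Implicit Defensive.
Set SsrOldRewriteGoalsOrder.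

Import Order.TTheory GRing.Theory Num.Theory.
Import numFieldNormedType.Exports.
Import ComplexField.Normc.

Local Open Scope classical_set_scope.
Local Open Scope ring_scope.
Local Open Scope quotient_scope.

Definition left_invariant_mean (R : realType) (G : groupType)
    (m : (G -> R) -> R) : Prop :=
  [/\ forall (f h : G -> R),
        [bounded f x | x in [set: G]] -> [bounded h x | x in [set: G]] ->
        m (fun x => f x + h x) = m f + m h,
      forall (c : R) (f : G -> R),
        [bounded f x | x in [set: G]] -> m (fun x => c * f x) = c * m f,
      forall f : G -> R,
        [bounded f x | x in [set: G]] -> (forall x, 0 <= f x) -> 0 <= m f,
      m (fun=> 1) = 1
    & forall (g : G) (f : G -> R),
        [bounded f x | x in [set: G]] -> m (fun x => f (g^-1 * x)%g) = m f].

(* Amenability of the discrete group G. The values of m outside of l^oo(G) are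
   irrelevant. *)
Definition amenable (R : realType) (G : groupType) : Prop :=
  exists m : (G -> R) -> R, left_invariant_mean m.

Section ell2.
Variables (R : realType) (G : choiceType).

Definition l2_pred : {pred G -> R[i]^o} := fun f =>
  `[< summable [set: G] (fun x => (normc (f x) ^+ 2)%:E) >].

Lemma l2_predP (f : G -> R[i]^o) : reflect
  (\esum_(x in [set: G]) (normc (f x) ^+ 2)%:E < +oo)%E (f \in l2_pred).
Proof.
apply: (iffP (asboolP _)); rewrite /summable.
  by under eq_esum do rewrite gee0_abs ?lee_fin ?sqr_ge0//.
by under [X in _ -> (X < _)%E]eq_esum do rewrite gee0_abs ?lee_fin ?sqr_ge0//.
Qed.

Lemma normc_ge0 (x : R[i]) : 0 <= normc x.
Proof. by case: x => a b /=; rewrite sqrtr_ge0. Qed.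

Lemma esum_scale_lty (a : R) (u : G -> R) :
  0 <= a -> (forall x, 0 <= u x) ->
  (\esum_(x in [set: G]) (u x)%:E < +oo)%E ->
  (\esum_(x in [set: G]) (a * u x)%:E < +oo)%E.
Proof.
move=> a0 u0 ul.
apply: (@le_lt_trans _ _ (a%:E * \esum_(x in [set: G]) (u x)%:E)%E).
  apply: ge_ereal_sup => _ [F [finF _] <-].
  under eq_fsbigr do rewrite EFinM.
  rewrite -ge0_mule_fsumr; last by move=> x; rewrite lee_fin.
  apply: lee_wpmul2l; first by rewrite lee_fin.
  by apply: esum_ge; exists F.
have : (0 <= \esum_(x in [set: G]) (u x)%:E)%E.
  by apply: esum_ge0 => x _; rewrite lee_fin.
by move: ul; case: (esum _ _) => // r _ _; rewrite -EFinM ltry.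
Qed.

Lemma l2_submod_closed : submod_closed l2_pred.
Proof.
split.
  apply/l2_predP; rewrite esum1 ?ltry// => x _.
  by rewrite [X in normc X](_ : _ = 0) // normc0 expr0n.
move=> c f h /l2_predP fl2 /l2_predP hl2; apply/l2_predP.
pose k := 2 * normc c ^+ 2.
have k0 : 0 <= k by rewrite mulr_ge0 ?sqr_ge0.
apply: (@le_lt_trans _ _
  (\esum_(x in [set: G]) (k * normc (f x) ^+ 2)%:E +
   \esum_(x in [set: G]) (2 * normc (h x) ^+ 2)%:E)%E).
  rewrite -esumD; first apply: le_esum => x _; last 2 first.
  - by move=> x _; rewrite lee_fin mulr_ge0 ?sqr_ge0.
  - by move=> x _; rewrite lee_fin mulr_ge0 ?sqr_ge0.
  rewrite -EFinD lee_fin /k -mulrA -exprMn -normcM -mulrDr.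
  apply: (@le_trans _ _ ((normc (c * f x) + normc (h x)) ^+ 2)).
    rewrite ler_sqr ?nnegrE ?addr_ge0 ?normc_ge0//.
    exact: le_normcD.
  rewrite -subr_ge0.
  set a := normc _; set b := normc _.
  suff -> : 2 * (a ^+ 2 + b ^+ 2) - (a + b) ^+ 2 = (a - b) ^+ 2.
    exact: sqr_ge0.
  by rewrite sqrrD sqrrB mulrDr !mulr_natl; rewrite !mulr2n; lra.
by apply: lte_add_pinfty; apply: esum_scale_lty => // x; exact: sqr_ge0.
Qed.

HB.instance Definition _ :=
  GRing.isSubmodClosed.Build R[i] (G -> R[i]^o) l2_pred l2_submod_closed.

Record l2 := L2 { l2val :> G -> R[i]^o ; _ : l2val \in l2_pred }.

HB.instance Definition _ := [isSub for l2val].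
HB.instance Definition _ := [Choice of l2 by <:].
HB.instance Definition _ := [SubChoice_isSubLmodule of l2 by <:].

Definition l2norm (xi : l2) : R :=
  Num.sqrt (fine (\esum_(x in [set: G]) (normc (xi x) ^+ 2)%:E)).

Definition opnorm (a : l2 -> l2) : \bar R :=
  ereal_sup [set (l2norm (a xi))%:E | xi in [set xi | l2norm xi <= 1]].

Definition bounded_operator (a : l2 -> l2) : Prop :=
  linear a /\ (opnorm a < +oo)%E.

(* Closure in B(l^2(G)) for the operator norm. *)
Definition op_closure (S : set (l2 -> l2)) : set (l2 -> l2) :=
  [set a | bounded_operator a /\
    forall e : R, 0 < e -> exists2 b, S b & (opnorm (a - b)%R < e%:E)%E].

End ell2.
Arguments l2 : clear implicits.

Section reduced_group_Cstar_algebra.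
Variables (R : realType) (G : groupType).

Definition left_translate (g : G) (f : G -> R[i]^o) : G -> R[i]^o :=
  fun x => f (g^-1 * x)%g.

Lemma left_translate_l2 (g : G) (xi : l2 R G) : left_translate g xi \in @l2_pred R G.
Proof.
apply/l2_predP; have /l2_predP := valP xi.
rewrite (@reindex_esum R _ _ [set: G] [set: G] (fun x => g^-1 * x)%g)//.
split => // [x y _ _ /mulgI //|y _].
by exists (g * y)%g => //; rewrite mulKg.
Qed.

Definition left_regular (g : G) (xi : l2 R G) : l2 R G :=
  L2 (left_translate_l2 g xi).

(* The image of the group algebra C[G] under the left regular representation;
   it is a *-algebra, so that its norm closure is C*_r(G). *)
Definition left_regular_span : set (l2 R G -> l2 R G) :=
  [set a | exists (n : nat) (c : 'I_n -> R[i]) (g : 'I_n -> G),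
     a = \sum_(i < n) c i *: left_regular (g i)].

Definition reduced_Cstar : set (l2 R G -> l2 R G) :=
  op_closure left_regular_span.

Definition closed_ideal (I : set (l2 R G -> l2 R G)) : Prop :=
  [/\ I `<=` reduced_Cstar,
      [/\ I 0,
          forall a b, I a -> I b -> I (a + b)
        & forall (c : R[i]) a, I a -> I (c *: a)],
      forall a b, reduced_Cstar a -> I b -> I (a \o b) /\ I (b \o a)
    & op_closure I `<=` I].

End reduced_group_Cstar_algebra.

Section circle.
Variable R : realType.

Definition eqmodZ (x y : R) : bool := x - y \is a Num.int.

Lemma eqmodZ_refl : reflexive eqmodZ.
Proof. by move=> x; rewrite /eqmodZ subrr rpred0. Qed.

Lemma eqmodZ_sym : symmetric eqmodZ.
Proof. by move=> x y; rewrite /eqmodZ -opprB rpredN. Qed.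

Lemma eqmodZ_trans : transitive eqmodZ.
Proof.
by move=> y x z xy yz; rewrite /eqmodZ -(subrKA y) rpredD.
Qed.

Definition eqmodZ_equiv : equiv_rel R :=
  EquivRel eqmodZ eqmodZ_refl eqmodZ_sym eqmodZ_trans.

Definition circle : Type := quotient_topology {eq_quot eqmodZ_equiv}.

HB.instance Definition _ := Topological.on circle.
HB.instance Definition _ := Quotient.on circle.

Definition cpi (x : R) : circle := \pi_circle x.

Lemma cpiP (x y : R) : cpi x = cpi y <-> x - y \is a Num.int.
Proof. by split => [/eqquotP//|xy]; exact/eqquotP. Qed.

(* Membership in Z[1/2]. *)
Definition dyadic (x : R) : Prop :=
  exists (m : int) (n : nat), x = m%:~R / 2 ^+ n.

Definition dyadic_points : set circle := cpi @` [set x | dyadic x].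

Definition homeomorphism (f : circle -> circle) : Prop :=
  exists g : circle -> circle,
    [/\ cancel f g, cancel g f, continuous f & continuous g].

(* Away from the finite set B of breakpoints, f has locally an affine lift to
   the real line, whose slope is a power of 2. *)
Definition dyadic_PL (f : circle -> circle) : Prop :=
  exists B : set circle,
    [/\ finite_set B, B `<=` dyadic_points
      & forall x : R, ~ B (cpi x) -> exists (k : int) (y : R),
          \forall t \near x, f (cpi t) = cpi (y + 2 ^ k * (t - x))].

Definition thompsonT_pred : {pred circle -> circle} := fun f =>
  `[< [/\ homeomorphism f, dyadic_PL f
        & {homo f : p / dyadic_points p}] >].

Record thompsonT := ThompsonT
  { thompsonT_fun :> circle -> circle; _ : thompsonT_fun \in thompsonT_pred }.

HB.instance Definition _ := [isSub for thompsonT_fun].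
HB.instance Definition _ := [Choice of thompsonT by <:].

Lemma dyadicD (x y : R) : dyadic x -> dyadic y -> dyadic (x + y).
Proof.
move=> [m [n ->]] [p [q ->]]; exists (m * 2 ^+ q + p * 2 ^+ n), (n + q)%N.
rewrite rmorphD !rmorphM !rmorphXn/= exprD.
have : (2 : R) ^+ n != 0 by rewrite expf_neq0.
have : (2 : R) ^+ q != 0 by rewrite expf_neq0.
rewrite -[2%:~R]/(2 : R); move: (2 ^+ n) (2 ^+ q) => a b b0 a0.
by field; rewrite b0 a0.
Qed.

Lemma dyadicN (x : R) : dyadic x -> dyadic (- x).
Proof. by move=> [m [n ->]]; exists (- m), n; rewrite rmorphN mulNr. Qed.

Lemma dyadicZ (k : int) (x : R) : dyadic x -> dyadic (2 ^ k * x).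
Proof.
move=> [m [n ->]]; case: k => k.
  exists (m * 2 ^+ k), n.
  by rewrite rmorphM rmorphXn/= mulrA [2 ^ _ * _]mulrC.
exists m, (n + k.+1)%N; rewrite NegzE -exprnN exprD invfM mulrA.
by field; rewrite !expf_neq0.
Qed.

Lemma dyadic_int (x : R) : x \is a Num.int -> dyadic x.
Proof. by move=> /intrP [m ->]; exists m, 0%N; rewrite expr0 divr1. Qed.

Lemma dyadic_pointsP (x : R) : dyadic_points (cpi x) <-> dyadic x.
Proof.
split=> [[y yd /cpiP yx]|xd]; last by exists x.
by rewrite -(subKr y x); apply: dyadicD => //; exact/dyadicN/dyadic_int.
Qed.

Lemma dyadic_dense (x e : R) : 0 < e ->
  exists2 y, dyadic y & `|x - y| < e.
Proof.
move=> e0; have [n ne] : exists n : nat, e^-1 < 2 ^+ n.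
  exists (Num.bound e^-1); apply: lt_trans (archi_boundP _) _.
    by rewrite invr_ge0 ltW.
  by rewrite -natrX ltr_nat ltn_expl.
have n0 : 0 < (2 : R) ^+ n by rewrite exprn_gt0.
exists ((Num.floor (x * 2 ^+ n))%:~R / 2 ^+ n); first by do 2 eexists.
have /andP[l u] := floor_itv (x * 2 ^+ n).
rewrite -[x in `|x - _|](mulfK (lt0r_neq0 n0)) -mulrBl normrM.
rewrite ger0_norm ?subr_ge0// gtr0_norm ?invr_gt0//.
rewrite ltr_pdivrMr//; apply: (@lt_trans _ _ 1).
  by rewrite ltrBlDl; rewrite intrD in u.
by rewrite -(@ltr_pM2l _ e^-1) ?invr_gt0// mulr1 mulKf ?lt0r_neq0.
Qed.

Lemma pow2_neq0 (k : int) : (2 : R) ^ k != 0.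
Proof. by rewrite expfz_neq0// pnatr_eq0. Qed.

Lemma thompsonT_dyadicV (f : circle -> circle) : f \in thompsonT_pred ->
  forall p, dyadic_points (f p) -> dyadic_points p.
Proof.
move=> /asboolP[_ [B [_ Bd fB]] fd] p.
have [/Bd//|Bp fp] := pselect (B p); move: Bp fp.
rewrite -[p]reprK -/(cpi _); move: (repr p) => x Bx fx.
have [k [y near_x]] := fB _ Bx.
have yd : dyadic y.
  have := nbhs_singleton near_x; rewrite subrr mulr0 addr0 => fxy.
  by apply/dyadic_pointsP; rewrite -fxy.
have [e /= e0 He] := near_x.
have [t td xt] := dyadic_dense x e0.
have := He t xt => ft; apply/dyadic_pointsP.
have : dyadic (y + 2 ^ k * (t - x)).
  by apply/dyadic_pointsP; rewrite -ft; apply/fd/dyadic_pointsP.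
move=> /(dyadicD (dyadicN yd)); rewrite addKr => /(dyadicZ (- k)).
rewrite mulrA -expfzDr ?pnatr_eq0// addNr expr0z mul1r.
move=> /dyadicN /(dyadicD td).
by rewrite opprB addrC subrK.
Qed.

Lemma cvg_affine (k : int) (y x : R) :
  (fun t : R => y + 2 ^ k * (t - x)) t @[t --> x] --> y.
Proof.
rewrite -[X in _ --> X]addr0 -(mulr0 (2 ^ k)) -(subrr x).
apply: cvgD; first exact: cvg_cst.
apply: cvgM; first exact: cvg_cst.
by apply: cvgB; [exact: cvg_id|exact: cvg_cst].
Qed.

Lemma thompsonT_id : id \in thompsonT_pred.
Proof.
apply/asboolP; split => //; first by exists id; split => // x; exact: cvg_id.
exists set0; split => // x _; exists 0, x; near=> t.
by rewrite expr0z mul1r addrC subrK.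
Unshelve. all: by end_near. Qed.

Lemma thompsonT_comp (f g : circle -> circle) :
  f \in thompsonT_pred -> g \in thompsonT_pred -> f \o g \in thompsonT_pred.
Proof.
move=> fT gT; have gV := thompsonT_dyadicV gT.
move/asboolP : fT => [[f' [ff' f'f fc f'c]] [B [Bfin Bd fB]] fd].
move/asboolP : gT => [[g' [gg' g'g gc g'c]] [C [Cfin Cd gC]] gd].
apply/asboolP; split.
- exists (g' \o f'); split; [exact: can_comp|exact: can_comp| |] => x.
    by apply: continuous_comp; [exact: gc|exact: fc].
  by apply: continuous_comp; [exact: f'c|exact: g'c].
- exists (C `|` g' @` B); split.
  + by rewrite finite_setU; split => //; exact: finite_image.
  + move=> p [/Cd//|[q /Bd qd <-]]; apply: gV; rewrite g'g//.
  + move=> x /not_orP[Cx Bx].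
    have [k [y gx]] := gC _ Cx.
    have gxy : g (cpi x) = cpi y.
      by have := nbhs_singleton gx; rewrite subrr mulr0 addr0.
    have By : ~ B (cpi y).
      by move=> By; apply: Bx; exists (cpi y) => //; rewrite -gxy gg'.
    have [l [z fy]] := fB _ By.
    exists (l + k), z.
    have c := @cvg_affine k y x.
    have fy' := c _ fy.
    near=> t; rewrite /= (near gx t)//.
    have -> : f (cpi (y + 2 ^ k * (t - x))) =
        cpi (z + 2 ^ l * (y + 2 ^ k * (t - x) - y)) by near: t.
    by rewrite addrAC subrr add0r mulrA -expfzDr.
- by move=> p /gd /fd.
Unshelve. all: by end_near. Qed.

Lemma thompsonT_inv (f g : circle -> circle) : f \in thompsonT_pred ->
  cancel f g -> cancel g f -> g \in thompsonT_pred.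
Proof.
move=> fT fg gf; have fV := thompsonT_dyadicV fT.
move/asboolP : fT => [[h [fh hf fc hc]] [B [Bfin Bd fB]] fd].
have gh : g = h by apply/funext => x; rewrite -[x in LHS]hf fg.
apply/asboolP; split.
- by exists f; rewrite gh.
- exists (f @` B); split; first exact: finite_image.
    by move=> _ [p /Bd pd <-]; exact: fd.
  move=> y By; pose x := repr (g (cpi y)).
  have gy : g (cpi y) = cpi x by rewrite /cpi reprK.
  have fx : f (cpi x) = cpi y by rewrite -gy gf.
  have Bx : ~ B (cpi x) by move=> Bx; apply: By; exists (cpi x).
  have [k [z nx]] := fB _ Bx.
  have /cpiP zy : cpi z = cpi y.
    by have := nbhs_singleton nx; rewrite subrr mulr0 addr0 fx.
  exists (- k), x.
  have c := @cvg_affine (- k) x y.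
  have nx' := c _ nx.
  near=> t.
  rewrite -[RHS]fg; congr g.
  have -> : f (cpi (x + 2 ^ (- k) * (t - y))) =
    cpi (z + 2 ^ k * (x + 2 ^ (- k) * (t - y) - x)) by near: t.
  rewrite [x + _]addrC addrK mulrA -expfzDr// subrr expr0z mul1r.
  apply/cpiP; rewrite -rpredN opprB.
  by rewrite (_ : _ - t = z - y)//; ring.
- by move=> p pd; apply: fV; rewrite gf.
Unshelve. all: by end_near. Qed.

Lemma thompsonT_bij (f : thompsonT) :
  {g : circle -> circle | cancel f g /\ cancel g f}.
Proof.
apply: cid; have /asboolP[[g [fg gf _ _]] _ _] := valP f.
by exists g.
Qed.

Definition thompsonT_one : thompsonT := ThompsonT thompsonT_id.

Definition thompsonT_mul (f g : thompsonT) : thompsonT :=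
  ThompsonT (thompsonT_comp (valP f) (valP g)).

Definition thompsonT_invg (f : thompsonT) : thompsonT :=
  ThompsonT (thompsonT_inv (valP f) (svalP (thompsonT_bij f)).1
                                    (svalP (thompsonT_bij f)).2).

Lemma thompsonT_mulA : associative thompsonT_mul.
Proof. by move=> f g h; apply: val_inj. Qed.

Lemma thompsonT_mul1 : left_id thompsonT_one thompsonT_mul.
Proof. by move=> f; apply: val_inj. Qed.

Lemma thompsonT_mulr1 : right_id thompsonT_one thompsonT_mul.
Proof. by move=> f; apply: val_inj. Qed.

Lemma thompsonT_mulV : left_inverse thompsonT_one thompsonT_invg thompsonT_mul.
Proof.
move=> f; apply: val_inj; apply/funext => x /=.
by rewrite (svalP (thompsonT_bij f)).1.
Qed.

Lemma thompsonT_mulVr : right_inverse thompsonT_one thompsonT_invg thompsonT_mul.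
Proof.
move=> f; apply: val_inj; apply/funext => x /=.
by rewrite (svalP (thompsonT_bij f)).2.
Qed.

HB.instance Definition _ := isGroup.Build thompsonT
  thompsonT_mulA thompsonT_mul1 thompsonT_mulr1 thompsonT_mulV thompsonT_mulVr.

Lemma thompsonT1E (x : circle) : (1%g : thompsonT) x = x.
Proof. by []. Qed.

Lemma thompsonTME (f g : thompsonT) (x : circle) : (f * g)%g x = f (g x).
Proof. by []. Qed.

Definition thompsonF_pred : {pred thompsonT} := fun f => f (cpi 0) == cpi 0.

Lemma thompsonF_group_closed : group_closed thompsonF_pred.
Proof.
split; first exact/eqP.
move=> f g /eqP f0 /eqP g0; apply/eqP.
by rewrite thompsonTME -[in g^-1%g _]g0 -[g^-1%g _]thompsonTME mulVg f0.
Qed.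

Record thompsonF := ThompsonF
  { thompsonF_val :> thompsonT; _ : thompsonF_val \in thompsonF_pred }.

HB.instance Definition _ := [isSub for thompsonF_val].
HB.instance Definition _ := [Choice of thompsonF by <:].
HB.instance Definition _ :=
  SubChoice_isSubGroup.Build _ _ thompsonF thompsonF_group_closed.

End circle.

(* Main.v *)
Require Import Defs.
From HB Require Import structures.
From mathcomp Require Import all_boot all_order all_algebra.
From mathcomp Require Import all_classical all_reals all_analysis.
From mathcomp Require Import complex ring lra zify.

Set Implicit Arguments.
Unset Strict Implicit.
Unset Printing Implicit Defensive.
Set SsrOldRewriteGoalsOrder.

Import Order.TTheory GRing.Theory Num.Theory.
Import numFieldNormedType.Exports.
Import ComplexField.Normc.

Local Open Scope classical_set_scope.
Local Open Scope ring_scope.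

(** For a subgroup H of a group G, the elements of the reduced C*-algebra of G
that the quasi-regular representation on l2(G/H) kills form a closed ideal,
provided that this representation is continuous for the reduced norm; it is so
when H is amenable. The theorem follows from a comparison of these ideals for
the pointwise stabilisers H of finite sets of points of the circle that contain
the point 0. Such a stabiliser is a subgroup of F, so it is amenable if F is.

Take elements b_0, b_1, ... of T with pairwise disjoint supports and points p_i
with b_i p_i <> p_i (explicit piecewise linear bumps on dyadic arcs that shrink
to 0), and let x_N be the product of the 1 - b_i for i < N, in the group
algebra. If H is the stabiliser of fewer than N points, then every translate of
these points misses the support of some b_i, so a factor 1 - b_i kills it:
x_N lies in the ideal of H (translate_sum_alt). If H stabilises
p_0, ..., p_(N-1), then 1 is the only term of the expansion of x_N that lies
in H, so the coefficients of x_N on H add up to 1 (coef_sum_alt), and x_N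
cannot lie in the ideal of H. Hence the stabilisers of 0, p_0, ..., p_(2n-1),
for varying n, give pairwise different ideals.

The last step needs that the sum of the coefficients on H is bounded by the
reduced norm (coef_sum_le_norm), which is where amenability enters. By
Namioka's argument, an invariant mean on H and the Hahn-Banach theorem produce
positive summable functions on H that are almost invariant in l1 norm
(almost_invariant_l1). Their square roots are almost invariant vectors of
l2(G) supported on H, and a finitely supported element of the group algebra
acts on such a vector, as far as H is concerned, almost as the sum of its
coefficients on H. *)

(** * Sublinear functionals *)

Section sublinear.
Variables (R : realType) (V : lmodType R).
Implicit Types (p q : V -> R) (u v : V).

Definition sublinear p :=
  (forall u v, p (u + v) <= p u + p v) /\
  (forall c u, 0 < c -> p (c *: u) <= c * p u).

Lemma sublinearZ p c u : sublinear p -> 0 < c -> p (c *: u) = c * p u.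
Proof.
move=> [_ pZ] c0; apply/eqP; rewrite eq_le pZ//=.
have := pZ c^-1 (c *: u).
by rewrite invr_gt0 scalerA mulVf ?gt_eqF// scale1r ler_pdivlMl// => ->.
Qed.

Lemma sublinear0 p : sublinear p -> p 0 = 0.
Proof.
move=> sp; have := @sublinearZ p 2 0 sp (ltr0Sn _ _).
by rewrite scaler0; lra.
Qed.

Lemma sublinear_opp p v : sublinear p -> - p (- v) <= p v.
Proof.
move=> sp; have := sp.1 v (- v).
by rewrite subrr (sublinear0 sp); lra.
Qed.

Lemma inf_sublinear (S : V -> set R) :
    (forall v, S v !=set0) -> (forall v, has_lbound (S v)) ->
    (forall u v x y, S u x -> S v y -> exists2 z, S (u + v) z & z <= x + y) ->
    (forall c u x, 0 < c -> S u x -> exists2 z, S (c *: u) z & z <= c * x) ->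
  sublinear (fun v => inf (S v)).
Proof.
move=> S0 Slb SD SZ; split => [u v|c u c0].
  rewrite -lerBlDr; apply: lb_le_inf => // x Sx.
  rewrite lerBlDr -lerBlDl; apply: lb_le_inf => // y Sy.
  have [z Sz zxy] := SD _ _ _ _ Sx Sy.
  by rewrite lerBlDl; apply: le_trans zxy; exact: ge_inf.
rewrite -ler_pdivrMl//; apply: lb_le_inf => // x Sx.
have [z Sz zx] := SZ _ _ _ c0 Sx.
by rewrite ler_pdivrMl//; apply: le_trans zx; exact: ge_inf.
Qed.

(** For a fixed a, the infimum over t >= 0 of p (v + t *: a) - t * p a is
sublinear, lies below p, and is at most - p a at v = - a. If p is minimal it
equals p, hence p is odd, and an odd sublinear functional is linear. *)
Lemma sublinear_minimal_linear p : sublinear p ->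
    (forall q, sublinear q -> (forall v, q v <= p v) -> q = p) ->
  scalar p.
Proof.
move=> sp pmin.
have pN a : p (- a) = - p a.
  pose S v := [set p (v + t *: a) - t * p a | t in [set t : R | 0 <= t]].
  have Slb v : has_lbound (S v).
    exists (- p (- v)) => _ [t /= t0 <-].
    have : t * p a <= p (v + t *: a) + p (- v).
      have -> : t * p a = p (t *: a).
        move: t0; rewrite le_eqVlt => /orP[/eqP<-|t0].
          by rewrite mul0r scale0r (sublinear0 sp).
        by rewrite (sublinearZ _ sp).
      by apply: le_trans (sp.1 _ _); rewrite addrAC subrr add0r.
    lra.
  have Sp v : S v (p v) by exists 0 => /=; rewrite ?scale0r ?mul0r ?addr0 ?subr0.
  have sq : sublinear (fun v => inf (S v)).
    apply: inf_sublinear => // [v|u v _ _ [s s0 <-] [t t0 <-]|c u _ c0 [t t0 <-]].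
    - by exists (p v).
    - exists (p (u + v + (s + t) *: a) - (s + t) * p a).
        by exists (s + t) => //=; exact: addr_ge0.
      have := sp.1 (u + s *: a) (v + t *: a).
      by rewrite scalerDl addrACA; lra.
    - exists (p (c *: u + (c * t) *: a) - (c * t) * p a).
        by exists (c * t) => //=; rewrite mulr_ge0// ltW.
      rewrite -scalerA -scalerDr mulrBr mulrA lerD2r.
      exact: sp.2.
  have qp : (fun v => inf (S v)) = p.
    by apply: pmin => // v; apply: ge_inf => //; exact: Sp.
  apply/eqP; rewrite eq_le; apply/andP; split; last first.
    by rewrite lerNl; have := sublinear_opp (- a) sp; rewrite opprK; lra.
  rewrite -[in leLHS]qp; apply: ge_inf => //; exists 1 => //=.
  by rewrite scale1r mul1r addNr (sublinear0 sp) sub0r.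
have pD u v : p (u + v) = p u + p v.
  apply/eqP; rewrite eq_le sp.1/=.
  have := sp.1 (u + v) (- v); rewrite addrK pN; lra.
move=> c u v; rewrite pD; congr (_ + _).
have [c0|c0|->] := ltgtP c 0; last first.
- by rewrite scale0r mul0r (sublinear0 sp).
- exact: sublinearZ.
- rewrite -[in LHS](opprK c) scaleNr pN (sublinearZ _ sp) ?oppr_gt0//.
  by rewrite mulNr opprK.
Qed.

(** Zorn's lemma provides a minimal sublinear functional below p: a chain of
them has a pointwise infimum because all of them lie above v |-> - p (- v). *)
Lemma hahn_banach p : sublinear p ->
  exists2 l : V -> R, scalar l & forall v, l v <= p v.
Proof.
move=> sp.
pose below q := sublinear q /\ forall v, q v <= p v.
pose T := {q | below q}.
pose le_T (q r : T) : bool := `[< forall v, sval r v <= sval q v >].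
have [||[q qP] [r rP] /asboolP/= qr /asboolP/= rq|A Atot|[l [sl lp]] lmin] :=
  @Zorn T le_T.
- by move=> q; apply/asboolP.
- move=> q r s /asboolP qr /asboolP rs; apply/asboolP => v.
  exact: le_trans (rs v) (qr v).
- apply: eq_exist; apply/funext => v.
  by apply/eqP; rewrite eq_le qr rq.
- have [[q0 Aq0]|A0] := pselect (A !=set0); last first.
    exists (exist below p (conj sp (fun v => lexx _))) => q Aq.
    by case: A0; exists q.
  pose S v := [set sval q v | q in A].
  have Slb v : has_lbound (S v).
    exists (- p (- v)) => _ [[q [sq qp]] Aq <-] /=.
    by have := sublinear_opp v sq; have := qp (- v); lra.
  have Sinf (q : T) v : A q -> inf (S v) <= sval q v.
    by move=> Aq; apply: ge_inf => //; exists q.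
  have sinf : sublinear (fun v => inf (S v)).
    apply: inf_sublinear => // [v|u v _ _ [q Aq <-] [r Ar <-]|c u _ c0 [q Aq <-]].
    - by exists (sval q0 v), q0.
    - have [s [As sq sr]] : exists s, [/\ A s,
          forall v, sval s v <= sval q v & forall v, sval s v <= sval r v].
        by have [/asboolP|/asboolP] := Atot q r Aq Ar; [exists r|exists q].
      exists (sval s (u + v)); first by exists s.
      by apply: le_trans ((svalP s).1.1 _ _) _; exact: lerD.
    - by exists (sval q (c *: u)); [exists q|exact: ((svalP q).1.2)].
  have infp v : inf (S v) <= p v.
    exact: le_trans (Sinf q0 v Aq0) ((svalP q0).2 v).
  exists (exist below _ (conj sinf infp)) => q Aq; apply/asboolP => v /=.
  exact: Sinf.
- exists l => //; apply: sublinear_minimal_linear => // q sq ql.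
  have qp v : q v <= p v by exact: le_trans (ql v) (lp v).
  by have /(congr1 sval) := lmin (exist below q (conj sq qp)) (asboolT ql).
Qed.

End sublinear.
(** * Sums of nonnegative families and the space of summable functions *)

Section total.
Variables (R : realType) (T : choiceType).
Implicit Types (u v : T -> R).

Definition finite_total u : Prop :=
  (\esum_(x in [set: T]) (u x)%:E < +oo)%E.

Definition total u : R := fine (\esum_(x in [set: T]) (u x)%:E).

Lemma esum_total u : (forall x, 0 <= u x) -> finite_total u ->
  \esum_(x in [set: T]) (u x)%:E = (total u)%:E.
Proof.
move=> u0; rewrite /finite_total /total.
have : (0 <= \esum_(x in [set: T]) (u x)%:E)%E.
  by apply: esum_ge0 => x _; rewrite lee_fin.
by case: (esum _ _).
Qed.

Lemma total_ge0 u : (forall x, 0 <= u x) -> 0 <= total u.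
Proof. by move=> u0; apply/fine_ge0/esum_ge0 => x _; rewrite lee_fin. Qed.

Lemma finite_total_le u v : (forall x, u x <= v x) ->
  finite_total v -> finite_total u.
Proof. by move=> uv; apply/le_lt_trans/le_esum => x _; rewrite lee_fin. Qed.

Lemma total_le u v : (forall x, 0 <= u x) -> (forall x, u x <= v x) ->
  finite_total v -> total u <= total v.
Proof.
move=> u0 uv fv; have fu := finite_total_le uv fv.
have v0 x : 0 <= v x by exact: le_trans (u0 x) (uv x).
rewrite -lee_fin -!esum_total//; apply: le_esum => x _.
by rewrite lee_fin.
Qed.

Lemma finite_totalD u v : (forall x, 0 <= u x) -> (forall x, 0 <= v x) ->
  finite_total u -> finite_total v -> finite_total (fun x => u x + v x).
Proof.
move=> u0 v0 fu fv; rewrite /finite_total.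
under eq_esum do rewrite EFinD.
rewrite esumD => [||x _]; rewrite ?lee_fin//.
  exact: lte_add_pinfty.
by move=> x _; rewrite lee_fin.
Qed.

Lemma totalD u v : (forall x, 0 <= u x) -> (forall x, 0 <= v x) ->
    finite_total u -> finite_total v ->
  total (fun x => u x + v x) = total u + total v.
Proof.
move=> u0 v0 fu fv; apply: EFin_inj; rewrite -esum_total.
- under eq_esum do rewrite EFinD.
  rewrite esumD => [||x _]; rewrite ?lee_fin//; last first.
    by move=> x _; rewrite lee_fin.
  by rewrite !esum_total.
- by move=> x; exact: addr_ge0.
- exact: finite_totalD.
Qed.

Lemma finite_totalZ (c : R) u : 0 <= c -> (forall x, 0 <= u x) ->
  finite_total u -> finite_total (fun x => c * u x).
Proof. exact: esum_scale_lty. Qed.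

Lemma totalZ (c : R) u : 0 <= c -> (forall x, 0 <= u x) -> finite_total u ->
  total (fun x => c * u x) = c * total u.
Proof.
have le_totalZ (a : R) v : 0 <= a -> (forall x, 0 <= v x) -> finite_total v ->
    total (fun x => a * v x) <= a * total v.
  move=> a0 v0 fv; rewrite -lee_fin -esum_total; last 2 first.
  - by move=> x; exact: mulr_ge0.
  - exact: finite_totalZ.
  apply: ge_ereal_sup => _ [F [finF _] <-].
  under eq_fsbigr do rewrite EFinM.
  rewrite -ge0_mule_fsumr; last by move=> x; rewrite lee_fin.
  rewrite EFinM; apply: lee_wpmul2l; first by rewrite lee_fin.
  by rewrite -esum_total//; apply: esum_ge; exists F.
move=> c0 u0 fu; apply/eqP; rewrite eq_le le_totalZ//=.
have [->|c_neq0] := eqVneq c 0.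
  by rewrite mul0r total_ge0// => x; rewrite mul0r.
have {c_neq0}c0 : 0 < c by rewrite lt_def c_neq0.
rewrite -ler_pdivlMl//.
have := @le_totalZ c^-1 (fun x => c * u x).
rewrite (_ : (fun x => c^-1 * (c * u x)) = u); last first.
  by apply/funext => x; rewrite mulKf// gt_eqF.
apply; first by rewrite invr_ge0 ltW.
- by move=> x; rewrite mulr_ge0// ltW.
- by apply: finite_totalZ => //; exact: ltW.
Qed.

Lemma total_reindex (e e' : T -> T) u : cancel e e' -> cancel e' e ->
  total (fun x => u (e x)) = total u.
Proof.
move=> eK e'K; rewrite /total [in RHS](@reindex_esum R T T setT setT e)//.
split=> // [x y _ _|y _]; first exact: (can_inj eK).
by exists (e' y).
Qed.

Lemma total_point t u : (forall x, 0 <= u x) -> (forall x, x != t -> u x = 0) ->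
  finite_total u /\ total u = u t.
Proof.
move=> u0 ut.
have E : \esum_(x in [set: T]) (u x)%:E = (u t)%:E.
  rewrite -[RHS](@esum_set1 _ _ t (fun x => (u x)%:E)) ?lee_fin//.
  rewrite [RHS]esum_mkcond; apply: eq_esum => x _.
  by case: ifPn => //; rewrite notin_setE/= => /eqP /ut ->.
by rewrite /finite_total /total E ltry.
Qed.

End total.

Section l1.
Variables (R : realType) (G : choiceType).

Definition l1_pred : {pred G -> R^o} := fun f =>
  `[< finite_total (fun x => `|f x|) >].

Lemma l1_submod_closed : submod_closed l1_pred.
Proof.
split.
  apply/asboolP; rewrite /finite_total esum1 ?ltry// => x _.
  by rewrite [X in `|X|](_ : _ = 0) ?normr0.
move=> c f h /asboolP fl1 /asboolP hl1; apply/asboolP.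
apply: (@finite_total_le _ _ _ (fun x => `|c| * `|f x| + `|h x|)) => [x|].
  by rewrite -normrM; exact: ler_normD.
by apply: finite_totalD => //; exact: finite_totalZ.
Qed.

HB.instance Definition _ :=
  GRing.isSubmodClosed.Build R (G -> R^o) l1_pred l1_submod_closed.

Record l1 := L1 { l1val :> G -> R^o ; _ : l1val \in l1_pred }.

HB.instance Definition _ := [isSub for l1val].
HB.instance Definition _ := [Choice of l1 by <:].
HB.instance Definition _ := [SubChoice_isSubLmodule of l1 by <:].

Definition l1norm (f : l1) : R := total (fun x => `|f x|).

Lemma l1P (f : l1) : finite_total (fun x => `|f x|).
Proof. exact/asboolP/(valP f). Qed.

Lemma l1norm_ge0 f : 0 <= l1norm f.
Proof. exact: total_ge0. Qed.

Lemma l1normD f h : l1norm (f + h) <= l1norm f + l1norm h.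
Proof.
rewrite -totalD//; [|exact: l1P|exact: l1P].
apply: total_le => // [x|]; first exact: ler_normD.
by apply: finite_totalD => //; exact: l1P.
Qed.

Lemma l1normZ (c : R) f : l1norm (c *: f) = `|c| * l1norm f.
Proof.
rewrite -totalZ//; last exact: l1P.
by congr total; apply/funext => x; rewrite -normrM.
Qed.

Lemma l1normN f : l1norm (- f) = l1norm f.
Proof. by rewrite -scaleN1r l1normZ normrN1 mul1r. Qed.

Lemma l1norm_nnegD (f h : l1) : (forall x, 0 <= f x) -> (forall x, 0 <= h x) ->
  l1norm (f + h) = l1norm f + l1norm h.
Proof.
move=> f0 h0; rewrite -totalD//; [|exact: l1P|exact: l1P].
congr total; apply/funext => x.
by rewrite !ger0_norm// addr_ge0.
Qed.

Lemma delta_l1 t : (fun x => (x == t)%:R) \in l1_pred.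
Proof.
apply/asboolP; apply: (total_point (t := t) _ _).1 => // x /negPf->.
by rewrite normr0.
Qed.

Definition delta (t : G) : l1 := L1 (delta_l1 t).

Lemma l1norm_delta t : l1norm (delta t) = 1.
Proof.
rewrite /l1norm (total_point (t := t) _ _).2//= => [|x /negPf ->].
  by rewrite eqxx normr1.
by rewrite normr0.
Qed.

End l1.
Arguments l1 : clear implicits.

Section l1_translate.
Variables (R : realType) (G : groupType).

Lemma translate_l1 (g : G) (f : l1 R G) :
  (fun x => f (g^-1 * x)%g) \in @l1_pred R G.
Proof.
apply/asboolP; have := l1P f; rewrite /finite_total.
rewrite (@reindex_esum R _ _ [set: G] [set: G] (fun x => g^-1 * x)%g)//.
split => // [x y _ _ /mulgI //|y _].
by exists (g * y)%g => //; rewrite mulKg.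
Qed.

Definition translate (g : G) (f : l1 R G) : l1 R G := L1 (translate_l1 g f).

Lemma translate_delta g t : translate g (delta R t) = delta R (g * t)%g.
Proof.
apply: val_inj; apply/funext => x /=.
by rewrite -(inj_eq (mulgI g)) mulVKg.
Qed.

End l1_translate.
(** * Invariant means and almost invariant summable functions *)

Section invariant_mean.
Variables (R : realType) (G : groupType).
Implicit Types (H : set G) (m : (G -> R) -> R).

Definition bounded_real (T : Type) (f : T -> R) : Prop :=
  exists M, forall x, `|f x| <= M.

Lemma bounded_realP (T : Type) (f : T -> R) :
  [bounded f x | x in [set: T]] <-> bounded_real f.
Proof.
split=> [/pinfty_ex_gt0 [M _ fM]|[M fM]].
  by exists M => x; exact: fM.
exists M; split; first exact: num_real.
by move=> N MN x _; apply: le_trans (fM x) (ltW MN).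
Qed.

(** An invariant mean on the subgroup H, read as a mean on the functions on G
that is concentrated on H. *)
Definition invariant_mean_on H m : Prop :=
  [/\ forall f h, bounded_real f -> bounded_real h ->
        m (fun x => f x + h x) = m f + m h,
      forall c f, bounded_real f -> m (fun x => c * f x) = c * m f,
      forall f, bounded_real f -> (forall x, 0 <= f x) -> 0 <= m f,
      m \1_H = 1
    & forall g f, H g -> bounded_real f -> m (fun x => f (g^-1 * x)%g) = m f].

Definition subgroup_set H : Prop :=
  [/\ H 1%g, forall x y, H x -> H y -> H (x * y)%g
    & forall x, H x -> H x^-1%g].

Lemma bounded_realD (T : Type) (f h : T -> R) : bounded_real f -> bounded_real h ->
  bounded_real (fun x => f x + h x).
Proof.
move=> [M fM] [N hN]; exists (M + N) => x.
by apply: le_trans (ler_normD _ _) _; exact: lerD.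
Qed.

Lemma bounded_realZ (T : Type) c (f : T -> R) : bounded_real f ->
  bounded_real (fun x => c * f x).
Proof.
by move=> [M fM]; exists (`|c| * M) => x; rewrite normrM ler_wpM2l.
Qed.

Lemma bounded_indic (T : Type) (A : set T) : bounded_real (\1_A : T -> R).
Proof.
by exists 1 => x; rewrite indicE; case: (_ \in _); rewrite ?normr1 ?normr0.
Qed.

Lemma bounded_real_sum (T : Type) (I : finType) (f : I -> T -> R) :
  (forall i, bounded_real (f i)) -> bounded_real (fun x => \sum_i f i x).
Proof.
move=> /choice[M fM]; exists (\sum_i M i) => x.
by apply: le_trans (ler_norm_sum _ _ _) _; exact: ler_sum.
Qed.

Section mean_theory.
Variables (H : set G) (m : (G -> R) -> R).
Hypothesis mP : invariant_mean_on H m.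

Lemma mean0 : m (fun=> 0) = 0.
Proof.
have [_ mZ _ _ _] := mP.
rewrite -[RHS](mul0r (m \1_H)) -mZ; last exact: bounded_indic.
by congr m; apply/funext => x; rewrite mul0r.
Qed.

Lemma mean_sum (I : finType) (f : I -> G -> R) :
  (forall i, bounded_real (f i)) -> m (fun x => \sum_i f i x) = \sum_i m (f i).
Proof.
have [mD _ _ _ _] := mP; move=> fb.
suff [] : bounded_real (fun x => \sum_i f i x) /\
          m (fun x => \sum_i f i x) = \sum_i m (f i) by [].
pose K (u : G -> R) a := bounded_real u /\ m u = a.
suff : K (fun x => \sum_i f i x) (\sum_i m (f i)) by [].
have -> : (fun x => \sum_i f i x) = \sum_i (f i : G -> R^o).
  by apply/funext => x; rewrite fct_sumE.
apply: (big_ind2 K) => [|u a v b [ub ua] [vb vb']|i _].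
- by split; [exists 0 => x; rewrite normr0|exact: mean0].
- by split; [exact: bounded_realD|rewrite -ua -vb' mD].
- by split.
Qed.

(** By invariance the mean of the divergence of a bounded flow along finitely
many elements of H is 0. *)
Lemma mean_no_divergence (I : finType) (s : I -> G) (phi : I -> G -> R) (e : R) :
    subgroup_set H -> (forall i, H (s i)) -> (forall i, bounded_real (phi i)) ->
    (forall x, H x -> e <= \sum_i (phi i (s i * x)%g - phi i x)) ->
  e <= 0.
Proof.
move=> [H1 HM HV] Hs phib ephi; have [mD mZ m0 mH minv] := mP.
(* Off H the functions are cut off, as the divergence is only controlled on H. *)
pose psi i x := \1_H x * phi i x.
have psib i : bounded_real (psi i).
  have [M phiM] := phib i; exists M => x; rewrite /psi indicE.
  case: (x \in H); rewrite ?mul1r// mul0r normr0.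
  exact: le_trans (normr_ge0 _) (phiM x).
have psisb i : bounded_real (fun x => psi i (s i * x)%g).
  by have [M psiM] := psib i; exists M => x; exact: psiM.
have psiNb i : bounded_real (fun x => -1 * psi i x) by exact: bounded_realZ.
pose div x := \sum_i (psi i (s i * x)%g + -1 * psi i x).
have divb : bounded_real div.
  by apply: bounded_real_sum => i; exact: bounded_realD.
have mdiv : m div = 0.
  rewrite mean_sum => [|i]; last exact: bounded_realD.
  apply: big1 => i _; rewrite mD// mZ//.
  rewrite -[in X in X + _](invgK (s i)) minv ?mulN1r ?subrr//; exact: HV.
have : 0 <= m (fun x => div x + - e * \1_H x).
  apply: m0 => [|x].
    by apply: bounded_realD => //; apply: bounded_realZ; exact: bounded_indic.
  have Hsx i : \1_H (s i * x)%g = \1_H x :> R.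
    rewrite !indicE; suff -> : (s i * x \in H)%g = (x \in H) by [].
    apply/idP/idP => /set_mem Hx; apply: mem_set; last exact: HM.
    by rewrite -(mulKg (s i) x); apply: HM => //; exact: HV.
  rewrite /div /psi; under eq_bigr do rewrite Hsx mulN1r -mulrBr.
  rewrite -mulr_sumr mulNr mulrC -mulrBl indicE.
  have [xH|_] := boolP (x \in H); last by rewrite mulr0.
  by rewrite mulr1 subr_ge0; apply: ephi; rewrite inE in xH.
rewrite mD//; last by apply: bounded_realZ; exact: bounded_indic.
rewrite mZ; last exact: bounded_indic.
by rewrite mdiv mH mulr1 add0r oppr_ge0.
Qed.

End mean_theory.
End invariant_mean.

(** Amenability passes to subgroups: choose a representative r of each coset
H x, so that x |-> x r^-1 is an H-equivariant retraction onto H, and push the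
mean forward along it. The larger group is only given through a morphism i
whose range contains H. *)
Lemma amenable_subgroup (R : realType) (G K : groupType) (i : K -> G) (H : set G) :
    {morph i : x y / (x * y)%g} -> subgroup_set H -> H `<=` range i ->
    amenable R K ->
  exists m : (G -> R) -> R, invariant_mean_on H m.
Proof.
move=> iM [H1 HM HV] Hi [m [mD mZ m0 m1 minv]].
pose coset x := [set y | H (i x * (i y)^-1)%g].
pose ret x := (i x * (i (xget 1%g (coset x)))^-1)%g.
have i1 : i 1%g = 1%g by apply: (mulgI (i 1%g)); rewrite -iM !mulg1.
have iV x : i x^-1%g = (i x)^-1%g.
  by apply: (mulgI (i x)); rewrite -iM !mulgV i1.
have Hret x : H (ret x).
  by apply: (@xgetPex _ 1%g (coset x)); exists x; rewrite /coset/= mulgV.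
have retM g x : H (i g) -> ret (g * x)%g = (i g * ret x)%g.
  move=> Hg; rewrite /ret iM -mulgA; congr (_ * (_ * (i (xget _ _))^-1))%g.
  apply/seteqP; split => y; rewrite /coset/= iM -mulgA => Hy; last exact: HM.
  by rewrite -(mulKg (i g) (_ * _)%g); apply: HM => //; exact: HV.
have retb f : bounded_real f -> [bounded f (ret x) | x in [set: K]].
  by move=> [M fM]; apply/bounded_realP; exists M => x; exact: fM.
exists (fun f => m (f \o ret)); split.
- by move=> f h /retb fb /retb hb; exact: mD.
- by move=> c f /retb fb; exact: mZ.
- by move=> f /retb fb f0; apply: m0 => // x; exact: f0.
- rewrite -[RHS]m1; congr m; apply/funext => x /=.
  by rewrite indicE mem_set.
- move=> g f Hg /retb fb; have [k _ kg] := Hi _ Hg; rewrite -[RHS](minv k)//.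
  congr m; apply/funext => x /=; rewrite retM iV kg//; exact: HV.
Qed.

Section almost_invariant.
Variables (R : realType) (G : groupType) (H : set G) (m : (G -> R) -> R).
Variables (I : finType) (s : I -> G).
Hypotheses (HP : subgroup_set H) (mP : invariant_mean_on H m).
Hypothesis Hs : forall i, H (s i).

Definition nneg_on (f : l1 R G) : Prop :=
  (forall x, 0 <= f x) /\ (forall x, ~ H x -> f x = 0).

Definition family_norm (v : I -> l1 R G) : R := \sum_i l1norm (v i).

Definition boundary (f : l1 R G) : I -> l1 R G :=
  fun i => translate (s i) f - f.

Lemma boundaryD f h : boundary (f + h) = boundary f + boundary h.
Proof.
apply/funext => i; apply: val_inj; apply/funext => x /=.
by rewrite opprD addrACA.
Qed.

Lemma boundaryZ c f : boundary (c *: f) = c *: boundary f.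
Proof.
apply/funext => i; apply: val_inj; apply/funext => x /=.
by rewrite scalerBr.
Qed.

Lemma family_normD v w : family_norm (v + w) <= family_norm v + family_norm w.
Proof. by rewrite -big_split; apply: ler_sum => i _; exact: l1normD. Qed.

Lemma family_normZ c v : family_norm (c *: v) = `|c| * family_norm v.
Proof. by rewrite mulr_sumr; apply: eq_bigr => i _; exact: l1normZ. Qed.

Lemma family_normN v : family_norm (- v) = family_norm v.
Proof. by apply: eq_bigr => i _; exact: l1normN. Qed.

(** Namioka's argument. Otherwise the boundaries of the positive functions f
on H have norm at least e * l1norm f, so that the infimum over f of
family_norm (v + boundary f) - e * l1norm f is finite and defines a sublinear
functional of v. A linear functional l below it is bounded by the norm, so its
values at point masses are bounded functions; and l at minus the boundary of a
point mass is at most - e, that is, these functions have divergence at least e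
at every point of H, which contradicts the existence of the mean. *)
Lemma almost_invariant_l1 (e : R) : 0 < e ->
  exists f, [/\ nneg_on f, 0 < l1norm f
    & family_norm (boundary f) < e * l1norm f].
Proof.
move=> e0; apply: contrapT => noninv.
have far f : nneg_on f -> e * l1norm f <= family_norm (boundary f).
  move=> fH; rewrite leNgt; apply/negP => fe; apply: noninv; exists f; split=> //.
  rewrite lt_def l1norm_ge0 andbT; apply/eqP => f0; move: fe; rewrite f0 mulr0.
  by rewrite ltNge sumr_ge0// => i _; exact: l1norm_ge0.
pose S v := [set family_norm (v + boundary f) - e * l1norm f | f in nneg_on].
have nnegD f h : nneg_on f -> nneg_on h -> nneg_on (f + h).
  move=> [f0 fH] [h0 hH]; split=> x; first exact: (addr_ge0 (f0 x) (h0 x)).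
  move=> Hx; have -> : (f + h) x = f x + h x :> R by [].
  by rewrite fH// hH// addr0.
have nnegZ (c : R) f : 0 < c -> nneg_on f -> nneg_on (c *: f).
  move=> c0 [f0 fH]; split=> x; first exact: (mulr_ge0 (ltW c0) (f0 x)).
  by move=> Hx; have -> : (c *: f) x = c * f x :> R by []; rewrite fH// mulr0.
have Slb v : has_lbound (S v).
  exists (- family_norm v) => _ [f /far ff <-].
  have := family_normD (v + boundary f) (- v).
  by rewrite addrAC subrr add0r family_normN; lra.
have Sv v : S v (family_norm v).
  exists 0; first by split.
  rewrite -(scale0r 0) boundaryZ l1normZ scale0r addr0.
  by rewrite normr0 mul0r mulr0 subr0.
have sp : sublinear (fun v => inf (S v)).
  apply: inf_sublinear => // [v|u v _ _ [f fH <-] [h hH <-]|c u _ c0 [f fH <-]].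
  - by exists (family_norm v).
  - exists (family_norm (u + v + boundary (f + h)) - e * l1norm (f + h)).
      by exists (f + h) => //; exact: nnegD.
    rewrite boundaryD addrACA l1norm_nnegD; [|exact: fH.1|exact: hH.1].
    by have := family_normD (u + boundary f) (v + boundary h); lra.
  - exists (family_norm (c *: u + boundary (c *: f)) - e * l1norm (c *: f)).
      by exists (c *: f) => //; exact: nnegZ.
    by rewrite boundaryZ -scalerDr family_normZ l1normZ gtr0_norm//; lra.
have [l l_lin lp] := hahn_banach sp.
have lD v w : l (v + w) = l v + l w by have := l_lin 1 v w; rewrite scale1r mul1r.
have l0 : l 0 = 0 by have := lD 0 0; rewrite addr0; lra.
have lN v : l (- v) = - l v by have := lD v (- v); rewrite subrr l0; lra.
have lle v : l v <= family_norm v by apply: le_trans (lp v) _; exact: ge_inf.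
pose single i w : I -> l1 R G := fun j => if j == i then w else 0.
pose phi i x := l (single i (delta R x)).
have phi1 i : bounded_real (phi i).
  exists 1 => x.
  have n1 : family_norm (single i (delta R x)) = 1.
    rewrite /family_norm (bigD1 i)//= /single eqxx l1norm_delta big1 ?addr0//.
    by move=> j /negPf ->; rewrite -(scale0r 0) l1normZ normr0 mul0r.
  rewrite ler_norml -{1 2}n1 lle andbT lerNl -lN.
  by apply: le_trans (lle _) _; rewrite family_normN.
suff : e <= 0 by rewrite leNgt e0.
apply: (mean_no_divergence mP HP Hs phi1) => x Hx.
have dxH : nneg_on (delta R x).
  split=> y; rewrite [delta R x y]/((y == x)%:R); first exact: ler0n.
  by move=> Hy; case: eqP => // yx; case: Hy; rewrite yx.
have -> : \sum_i (phi i (s i * x)%g - phi i x) = l (boundary (delta R x)).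
  transitivity (l (\sum_i (single i (delta R (s i * x)%g) - single i (delta R x)))).
    rewrite (big_morph l lD l0); apply: eq_bigr => i _.
    by rewrite lD lN.
  congr l; apply/funext => j; rewrite fct_sumE.
  have E i : (single i (delta R (s i * x)%g) - single i (delta R x)) j =
      if j == i then delta R (s i * x)%g - delta R x else 0.
    transitivity (single i (delta R (s i * x)%g) j - single i (delta R x) j) => //.
    by rewrite /single; case: ifP; rewrite ?subrr.
  under eq_bigr do rewrite E.
  rewrite -big_mkcond (big_pred1 j) => [|i]; last by rewrite eq_sym.
  by rewrite /boundary translate_delta.
rewrite -[l _]opprK -lN lerNr; apply: le_trans (lp _) _; apply: ge_inf => //.
exists (delta R x) => //; rewrite addNr l1norm_delta mulr1.
by rewrite -(scale0r 0) family_normZ normr0 mul0r sub0r.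
Qed.

End almost_invariant.
(** * The norm of l2 and bounded operators *)

Section l2_norm.
Variables (R : realType) (G : choiceType).
Implicit Types (xi eta : l2 R G).

Lemma finite_total_l2 xi : finite_total (fun x => normc (xi x) ^+ 2).
Proof. exact/l2_predP/(valP xi). Qed.

Lemma l2norm_ge0 xi : 0 <= l2norm xi.
Proof. exact: sqrtr_ge0. Qed.

Lemma sqr_l2norm xi : l2norm xi ^+ 2 = total (fun x => normc (xi x) ^+ 2).
Proof. by rewrite sqr_sqrtr// total_ge0// => x; exact: sqr_ge0. Qed.

Lemma l2norm_le xi eta : (forall x, normc (xi x) <= normc (eta x)) ->
  l2norm xi <= l2norm eta.
Proof.
move=> xe; rewrite -ler_sqr ?nnegrE ?l2norm_ge0// !sqr_l2norm.
apply: total_le => [x|x|]; [exact: sqr_ge0| |exact: finite_total_l2].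
by rewrite ler_sqr ?nnegrE ?normc_ge0.
Qed.

Lemma l2normZ (c : R[i]) xi : l2norm (c *: xi) = normc c * l2norm xi.
Proof.
apply/eqP; rewrite -(@eqrXn2 _ 2) ?mulr_ge0 ?normc_ge0 ?l2norm_ge0//; apply/eqP.
rewrite exprMn !sqr_l2norm -totalZ.
- by congr total; apply/funext => x; rewrite -exprMn -normcM.
- exact: sqr_ge0.
- by move=> x; exact: sqr_ge0.
- exact: finite_total_l2.
Qed.

Lemma l2norm0 : l2norm (0 : l2 R G) = 0.
Proof. by rewrite -(scale0r 0) l2normZ normc0 mul0r. Qed.

Lemma l2normN xi : l2norm (- xi) = l2norm xi.
Proof.
rewrite -scaleN1r l2normZ (_ : normc (-1) = 1) ?mul1r//.
by rewrite /normc/= oppr0 expr0n addr0 sqrrN expr1n sqrtr1.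
Qed.

(** Minkowski's inequality: for t > 0 the square of a sum is bounded by
(1 + t) a^2 + (1 + t^-1) b^2, which can be summed over the points; the choice
t = |eta| / |xi| is optimal. A shift by d avoids a division by 0. *)
Lemma l2normD xi eta : l2norm (xi + eta) <= l2norm xi + l2norm eta.
Proof.
have weighted (t : R) : 0 < t ->
    l2norm (xi + eta) ^+ 2 <=
    (1 + t) * l2norm xi ^+ 2 + (1 + t^-1) * l2norm eta ^+ 2.
  move=> t0; have ti0 : 0 < t^-1 by rewrite invr_gt0.
  have fx c (z : l2 R G) : 0 <= c -> finite_total (fun x => c * normc (z x) ^+ 2).
    move=> c0; apply: finite_totalZ => // [x|]; first exact: sqr_ge0.
    exact: finite_total_l2.
  have c1 : 0 <= 1 + t by lra.
  have c2 : 0 <= 1 + t^-1 by lra.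
  rewrite !sqr_l2norm -!totalZ//; try exact: finite_total_l2;
    try by move=> x; exact: sqr_ge0.
  rewrite -totalD; try exact: fx; try by move=> x; rewrite mulr_ge0// sqr_ge0.
  apply: total_le => [x|x|]; first exact: sqr_ge0; last first.
    by apply: finite_totalD; try exact: fx; move=> x; rewrite mulr_ge0// sqr_ge0.
  have : normc ((xi + eta) x) <= normc (xi x) + normc (eta x) by exact: le_normcD.
  set n := normc ((xi + eta) x); set a := normc _; set b := normc _ => nab.
  have n0 : 0 <= n by exact: normc_ge0.
  have : n ^+ 2 <= (a + b) ^+ 2 by rewrite ler_sqr ?nnegrE// (le_trans n0 nab).
  move=> /le_trans; apply.
  have : 0 <= t * (a - t^-1 * b) ^+ 2 by rewrite mulr_ge0 ?sqr_ge0 ?ltW.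
  have -> : t * (a - t^-1 * b) ^+ 2 = t * a ^+ 2 - 2 * a * b + t^-1 * b ^+ 2.
    by field; rewrite gt_eqF.
  by move=> h; rewrite sqrrD !mulr2n; lra.
apply/ler_addgt0Pl => d d0.
set a := l2norm xi in weighted *; set b := l2norm eta in weighted *.
have a0 : 0 <= a by exact: l2norm_ge0.
have b0 : 0 <= b by exact: l2norm_ge0.
pose a' := a + d / 2; pose b' := b + d / 2.
have a'0 : 0 < a' by rewrite /a'; lra.
have b'0 : 0 < b' by rewrite /b'; lra.
have -> : d + (a + b) = a' + b' by rewrite /a' /b'; lra.
rewrite -ler_sqr ?nnegrE ?l2norm_ge0//; last by rewrite ltW// addr_gt0.
have t0 : 0 < b' / a' by rewrite divr_gt0.
apply: le_trans (weighted _ t0) _.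
have -> : (a' + b') ^+ 2 = (1 + b' / a') * a' ^+ 2 + (1 + (b' / a')^-1) * b' ^+ 2.
  by field; rewrite !gt_eqF.
have ti0 : 0 < (b' / a')^-1 by rewrite invr_gt0.
apply: lerD; apply: ler_wpM2l; [lra| |lra|].
- by rewrite ler_sqr ?nnegrE ?(ltW a'0)// /a'; lra.
- by rewrite ler_sqr ?nnegrE ?(ltW b'0)// /b'; lra.
Qed.

Lemma l2norm_sum (I : Type) (r : seq I) (P : pred I) (F : I -> l2 R G) :
  l2norm (\sum_(i <- r | P i) F i) <= \sum_(i <- r | P i) l2norm (F i).
Proof.
apply: (big_ind2 (fun u (a : R) => l2norm u <= a)) => //.
  by rewrite l2norm0.
by move=> u a v b ua vb; apply: le_trans (l2normD _ _) _; exact: lerD.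
Qed.

End l2_norm.

Section op_bound.
Variables (R : realType) (G : choiceType).
Implicit Types (a b : l2 R G -> l2 R G) (C D : R).

Definition op_bound a C : Prop := forall xi, l2norm (a xi) <= C * l2norm xi.

Lemma op_bound_opnorm a C : 0 <= C -> op_bound a C -> (opnorm a <= C%:E)%E.
Proof.
move=> C0 aC; apply: ge_ereal_sup => _ [xi /= xi1 <-]; rewrite lee_fin.
by apply: le_trans (aC xi) _; rewrite ler_piMr.
Qed.

Lemma opnorm_op_bound a C : linear a -> (opnorm a <= C%:E)%E -> op_bound a C.
Proof.
move=> a_lin aC.
have unit_ball xi : l2norm xi <= 1 -> l2norm (a xi) <= C.
  move=> xi1; rewrite -lee_fin; apply: le_trans aC; apply: ereal_sup_ubound.
  by exists xi.
have aZ (c : R) xi : 0 <= c -> l2norm (a (c%:C%C *: xi)) = c * l2norm (a xi).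
  move=> c0; have a0 : a 0 = 0.
    have := a_lin (-1) 0 0; rewrite scaler0 addr0.
    by rewrite scaleN1r addNr.
  have -> : a (c%:C%C *: xi) = c%:C%C *: a xi.
    by have := a_lin c%:C%C xi 0; rewrite a0 !addr0.
  by rewrite l2normZ /= expr0n addr0 sqrtr_sqr ger0_norm.
have nZ (c : R) (xi : l2 R G) : 0 <= c -> l2norm (c%:C%C *: xi) = c * l2norm xi.
  by move=> c0; rewrite l2normZ /= expr0n addr0 sqrtr_sqr ger0_norm.
move=> xi; have [xi0|xi0] := eqVneq (l2norm xi) 0.
  rewrite xi0 mulr0 leNgt; apply/negP => axi.
  have := @unit_ball (((`|C| + 1) / l2norm (a xi))%:C%C *: xi).
  have c0 : 0 <= (`|C| + 1) / l2norm (a xi) by rewrite divr_ge0 ?addr_ge0// ltW.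
  rewrite nZ// xi0 mulr0 ler01 aZ// divfK ?gt_eqF// => /(_ isT).
  by have := ler_norm C; lra.
have n0 : 0 < l2norm xi by rewrite lt_def xi0 l2norm_ge0.
have := @unit_ball ((l2norm xi)^-1%:C%C *: xi).
have c0 : 0 <= (l2norm xi)^-1 by rewrite invr_ge0 ltW.
by rewrite nZ// mulVf// aZ// ler_pdivrMl// mulrC => /(_ (lexx _)).
Qed.

Lemma op_bound_lt a e : 0 < e -> op_bound a (e / 2) -> (opnorm a < e%:E)%E.
Proof.
move=> e0 ae; apply: (@le_lt_trans _ _ (e / 2)%:E); last by rewrite lte_fin; lra.
by apply: op_bound_opnorm => //; lra.
Qed.

Lemma bounded_operatorP a :
  bounded_operator a <-> linear a /\ exists2 C, 0 <= C & op_bound a C.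
Proof.
split=> [[a_lin a_bd]|[a_lin [C C0 aC]]]; last first.
  by split=> //; apply: le_lt_trans (op_bound_opnorm C0 aC) _; rewrite ltry.
split=> //; move: a_bd (fun C => @opnorm_op_bound a C a_lin).
case: (opnorm a) => // [C _ /(_ C (lexx _)) aC|_ /(_ 0 (leNye _)) a0].
  exists `|C| => // xi; apply: le_trans (aC xi) _.
  by apply: ler_wpM2r; [exact: l2norm_ge0|exact: ler_norm].
by exists 0.
Qed.

Lemma op_boundW a C D : C <= D -> op_bound a C -> op_bound a D.
Proof.
move=> CD aC xi; apply: le_trans (aC xi) _.
by apply: ler_wpM2r => //; exact: l2norm_ge0.
Qed.

Lemma op_boundD a b C D : op_bound a C -> op_bound b D -> op_bound (a + b) (C + D).
Proof.
move=> aC bD xi; apply: le_trans (l2normD _ _) _.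
by rewrite mulrDl; exact: lerD.
Qed.

Lemma op_bound_comp a b C D : 0 <= C ->
  op_bound a C -> op_bound b D -> op_bound (a \o b) (C * D).
Proof.
move=> C0 aC bD xi; apply: le_trans (aC _) _.
by rewrite -mulrA; apply: ler_wpM2l.
Qed.

Lemma op_boundZ (c : R[i]) a C : op_bound a C -> op_bound (c *: a) (normc c * C).
Proof.
move=> aC xi; rewrite [X in l2norm X](_ : _ = c *: a xi)// l2normZ -mulrA.
by apply: ler_wpM2l => //; exact: normc_ge0.
Qed.

Lemma bounded_operator0 : @bounded_operator R G 0.
Proof.
apply/bounded_operatorP; split.
  by move=> c xi eta; rewrite [LHS](_ : _ = 0)// scaler0 add0r.
by exists 0 => // xi; rewrite mul0r l2norm0.
Qed.

Lemma bounded_operatorD a b :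
  bounded_operator a -> bounded_operator b -> bounded_operator (a + b).
Proof.
move=> /bounded_operatorP[al [C C0 aC]] /bounded_operatorP[bl [D D0 bD]].
apply/bounded_operatorP; split.
  move=> c xi eta; rewrite [LHS](_ : _ = a (c *: xi + eta) + b (c *: xi + eta))//.
  by rewrite al bl addrACA -scalerDr.
by exists (C + D); [exact: addr_ge0|exact: op_boundD].
Qed.

Lemma bounded_operatorZ (c : R[i]) a :
  bounded_operator a -> bounded_operator (c *: a).
Proof.
move=> /bounded_operatorP[al [C C0 aC]].
apply/bounded_operatorP; split.
  move=> d xi eta; rewrite [LHS](_ : _ = c *: a (d *: xi + eta))//.
  by rewrite al scalerDr !scalerA mulrC -scalerA.
by exists (normc c * C); [exact: mulr_ge0 (normc_ge0 _) C0|exact: op_boundZ].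
Qed.

Lemma bounded_operator_comp a b :
  bounded_operator a -> bounded_operator b -> bounded_operator (a \o b).
Proof.
move=> /bounded_operatorP[al [C C0 aC]] /bounded_operatorP[bl [D D0 bD]].
apply/bounded_operatorP; split; first by move=> c xi eta; rewrite /= bl al.
by exists (C * D); [exact: mulr_ge0|exact: op_bound_comp].
Qed.

Lemma linearB_op a xi eta : linear a -> a (xi - eta) = a xi - a eta.
Proof. by move=> al; rewrite -scaleN1r addrC al scaleN1r addrC. Qed.

Lemma opnormB_lt_op_bound a b e : bounded_operator a -> bounded_operator b ->
  (opnorm (a - b)%R < e%:E)%E -> op_bound (a - b) e.
Proof.
move=> ab bb /ltW; apply: opnorm_op_bound.
by rewrite -scaleN1r; exact: (bounded_operatorD ab (bounded_operatorZ _ bb)).1.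
Qed.

End op_bound.
(** * Finitely supported elements and their coset sums *)

Section group_algebra.
Variables (R : realType) (G : groupType).
Implicit Types (s : seq (R[i] * G)) (H : set G) (e : R).

(** A list of pairs stands for a linear combination of group elements, in
which a group element may be repeated. *)
Definition lreg s : l2 R G -> l2 R G :=
  \sum_(p <- s) p.1 *: @left_regular R G p.2.

Definition coef_sum H s : R[i] := \sum_(p <- s | `[< H p.2 >]) p.1.

Definition coef_norm s : R := \sum_(p <- s) normc p.1.

Definition scale_seq (c : R[i]) s := [seq (c * p.1, p.2) | p <- s].

Definition mul_seq s t := [seq (p.1 * q.1, (p.2 * q.2)%g) | p <- s, q <- t].

Lemma coef_norm_ge0 s : 0 <= coef_norm s.
Proof. by apply: sumr_ge0 => p _; exact: normc_ge0. Qed.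

Lemma lregE s xi : lreg s xi = \sum_(p <- s) p.1 *: left_regular p.2 xi.
Proof. by rewrite /lreg fct_sumE. Qed.

Lemma lreg_cat s t : lreg (s ++ t) = lreg s + lreg t.
Proof. exact: big_cat. Qed.

Lemma lreg_scale c s : lreg (scale_seq c s) = c *: lreg s.
Proof.
rewrite /lreg big_map scaler_sumr; apply: eq_bigr => p _.
by rewrite scalerA.
Qed.

Lemma left_regular_linear g : linear (@left_regular R G g).
Proof. by move=> c xi eta; apply: val_inj. Qed.

Lemma left_regularM g h (xi : l2 R G) :
  left_regular (g * h)%g xi = left_regular g (left_regular h xi).
Proof.
apply: val_inj; apply/funext => x; rewrite /= /left_translate /=.
by rewrite invgM mulgA.
Qed.

Lemma l2norm_left_regular g (xi : l2 R G) : l2norm (left_regular g xi) = l2norm xi.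
Proof.
apply/eqP; rewrite -(@eqrXn2 _ 2) ?l2norm_ge0// !sqr_l2norm; apply/eqP.
apply: (total_reindex (e := fun x => (g^-1 * x)%g) (e' := fun x => (g * x)%g)
  (fun x => normc (xi x) ^+ 2)) => x; [exact: mulVKg|exact: mulKg].
Qed.

Lemma lreg_linear s : linear (lreg s).
Proof.
move=> c xi eta; rewrite !lregE scaler_sumr -big_split; apply: eq_bigr => p _.
by rewrite left_regular_linear scalerDr !scalerA mulrC.
Qed.

Lemma lreg_mul s t : lreg (mul_seq s t) = lreg s \o lreg t.
Proof.
apply/funext => xi; rewrite lregE /mul_seq big_allpairs_dep /= lregE.
apply: eq_bigr => p _.
have pl := left_regular_linear p.2.
have p0 : left_regular p.2 0 = 0 :> l2 R G by apply: val_inj.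
have pD (u v : l2 R G) :
    left_regular p.2 (u + v) = left_regular p.2 u + left_regular p.2 v.
  exact: val_inj.
rewrite lregE (big_morph _ pD p0) scaler_sumr; apply: eq_bigr => q _.
rewrite /= left_regularM -scalerA; congr (_ *: _).
exact: val_inj.
Qed.

Lemma op_bound_lreg s : op_bound (lreg s) (coef_norm s).
Proof.
move=> xi; rewrite lregE mulr_suml; apply: le_trans (l2norm_sum _ _ _) _.
by apply: ler_sum => p _; rewrite l2normZ l2norm_left_regular.
Qed.

Lemma bounded_lreg s : bounded_operator (lreg s).
Proof.
apply/bounded_operatorP; split; first exact: lreg_linear.
by exists (coef_norm s); [exact: coef_norm_ge0|exact: op_bound_lreg].
Qed.

Lemma left_regular_spanP a : left_regular_span a <-> exists s, a = lreg s.
Proof.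
split=> [[n [c [g ->]]]|[s ->]].
  exists [seq (c i, g i) | i <- index_enum 'I_n].
  by rewrite /lreg big_map.
exists (size s), (fun i => (nth (0, 1%g) s i).1), (fun i => (nth (0, 1%g) s i).2).
by rewrite /lreg (big_nth (0, 1%g)) big_mkord.
Qed.

Lemma reduced_CstarP a : reduced_Cstar a <-> bounded_operator a /\
  forall e, 0 < e -> exists s, op_bound (a - lreg s) e.
Proof.
split=> -[ab ac]; split=> // e e0.
  have [_ /left_regular_spanP[s ->] sa] := ac e e0.
  by exists s; apply: opnormB_lt_op_bound sa => //; exact: bounded_lreg.
have [|s sa] := ac (e / 2); first by rewrite divr_gt0.
exists (lreg s); first by apply/left_regular_spanP; exists s.
exact: op_bound_lt.
Qed.

Lemma coef_sum_cat H s t : coef_sum H (s ++ t) = coef_sum H s + coef_sum H t.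
Proof. exact: big_cat. Qed.

Lemma coef_sum_scale H c s : coef_sum H (scale_seq c s) = c * coef_sum H s.
Proof. by rewrite /coef_sum big_map mulr_sumr. Qed.

Lemma coef_sum_mull H s t : coef_sum H (mul_seq s t) =
  \sum_(p <- s) p.1 * coef_sum [set k | H (p.2 * k)%g] t.
Proof.
rewrite /coef_sum /mul_seq big_mkcond big_allpairs_dep /=.
apply: eq_bigr => p _; rewrite mulr_sumr [RHS]big_mkcond; apply: eq_bigr => q _.
by case: ifP => //; rewrite mulr0.
Qed.

Lemma coef_sum_mulr H s t : coef_sum H (mul_seq s t) =
  \sum_(q <- t) q.1 * coef_sum [set k | H (k * q.2)%g] s.
Proof.
rewrite /coef_sum /mul_seq big_mkcond big_allpairs_dep /= exchange_big /=.
apply: eq_bigr => q _; rewrite mulr_sumr [RHS]big_mkcond; apply: eq_bigr => p _.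
by case: ifP => // _; rewrite mulrC.
Qed.

Lemma normcD (z w : R[i]) : normc (z + w) <= normc z + normc w.
Proof. exact: le_normcD. Qed.

Lemma normc_sum (I : Type) (r : seq I) (F : I -> R[i]) :
  normc (\sum_(i <- r) F i) <= \sum_(i <- r) normc (F i).
Proof.
apply: (big_ind2 (fun z (a : R) => normc z <= a)) => //; first by rewrite normc0.
by move=> z a w b za wb; apply: le_trans (normcD _ _) _; exact: lerD.
Qed.

End group_algebra.

(** * The ideal attached to a subset of the group *)

Section coset_ideal.
Variables (R : realType) (G : groupType) (H : set G).
Implicit Types (s : seq (R[i] * G)) (e : R).

(** When H is a subgroup these are the matrix coefficients, for the standard
basis of l2(G/H), of the quasi-regular representation. *)
Definition translate_sum s u v : R[i] := coef_sum [set k | H (u * k * v)%g] s.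

Definition small_translate_sums s e : Prop :=
  forall u v, normc (translate_sum s u v) <= e.

(** If H is an amenable subgroup, this is the kernel of the extension of the
quasi-regular representation to the reduced C*-algebra. Written with
approximants, it is a closed ideal for every subset H, before any norm bound
that makes the representation extend. *)
Definition coset_ideal : set (l2 R G -> l2 R G) :=
  [set a | bounded_operator a /\ forall e, 0 < e ->
    exists s, op_bound (a - lreg s) e /\ small_translate_sums s e].

Lemma small_translate_sums_cat s t d e : small_translate_sums s d ->
  small_translate_sums t e -> small_translate_sums (s ++ t) (d + e).
Proof.
move=> sd te u v; rewrite /translate_sum coef_sum_cat.
by apply: le_trans (normcD _ _) _; exact: (lerD (sd u v) (te u v)).
Qed.

Lemma small_translate_sums_mull s t e : small_translate_sums t e ->
  small_translate_sums (mul_seq s t) (coef_norm s * e).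
Proof.
move=> te u v; rewrite /translate_sum coef_sum_mull mulr_suml.
apply: le_trans (normc_sum _ _) _; apply: ler_sum => p _.
rewrite normcM; apply: ler_wpM2l; first exact: normc_ge0.
have := te (u * p.2)%g v; rewrite /translate_sum.
by congr (normc (coef_sum _ _) <= _); apply/seteqP; split=> k /=; rewrite !mulgA.
Qed.

Lemma small_translate_sums_mulr s t e : small_translate_sums s e ->
  small_translate_sums (mul_seq s t) (coef_norm t * e).
Proof.
move=> se u v; rewrite /translate_sum coef_sum_mulr mulr_suml.
apply: le_trans (normc_sum _ _) _; apply: ler_sum => q _.
rewrite normcM; apply: ler_wpM2l; first exact: normc_ge0.
have := se u (q.2 * v)%g; rewrite /translate_sum.
by congr (normc (coef_sum _ _) <= _); apply/seteqP; split=> k /=; rewrite !mulgA.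
Qed.

Lemma small_translate_sumsW s d e : d <= e ->
  small_translate_sums s d -> small_translate_sums s e.
Proof. by move=> de sd u v; apply: le_trans de. Qed.

Lemma small_part (B e : R) : 0 <= B -> 0 < e ->
  exists2 d, 0 < d & d * B <= e / 2.
Proof.
move=> B0 e0; have B1 : 0 < B + 1 by lra.
exists (e / 2 / (B + 1)); first by rewrite !divr_gt0.
by rewrite mulrAC ler_pdivrMr// ler_wpM2l//; lra.
Qed.

(** Multiplying the approximants of b by a fixed approximant of a keeps the
translate sums small, since a fixed finitely supported element multiplies the
supremum of these sums by at most its l1 norm. *)
Lemma coset_ideal_closed_ideal : closed_ideal coset_ideal.
Proof.
split.
- move=> a [ab aI]; apply/reduced_CstarP; split=> // e /aI [s [sa _]].
  by exists s.
- split.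
  + split=> [|e e0]; first exact: bounded_operator0.
    exists [::]; split=> [xi|u v].
      rewrite /lreg big_nil subr0 l2norm0 mulr_ge0 ?l2norm_ge0//.
      exact: ltW.
    by rewrite /translate_sum /coef_sum big_nil normc0 ltW.
  + move=> a b [ab aI] [bb bI]; split=> [|e e0]; first exact: bounded_operatorD.
    have e20 : 0 < e / 2 by rewrite divr_gt0.
    have [s [sa ss]] := aI _ e20; have [t [tb ts]] := bI _ e20.
    exists (s ++ t); rewrite (splitr e); split.
      rewrite lreg_cat opprD addrACA; exact: op_boundD.
    exact: small_translate_sums_cat.
  + move=> c a [ab aI]; split=> [|e e0]; first exact: bounded_operatorZ.
    have c0 := normc_ge0 c.
    have c10 : 0 < normc c + 1 by lra.
    have [|s [sa ss]] := aI (e / (normc c + 1)); first by rewrite divr_gt0.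
    have ce : normc c * (e / (normc c + 1)) <= e.
      by rewrite mulrA ler_pdivrMr// mulrC ler_wpM2l//; lra.
    exists (scale_seq c s); split.
      by rewrite lreg_scale -scalerBr; apply: op_boundW ce _; exact: op_boundZ.
    move=> u v; rewrite /translate_sum coef_sum_scale normcM.
    by apply: le_trans ce; exact: (ler_wpM2l c0 (ss u v)).
- move=> a b /reduced_CstarP[ab aC] [bb bI].
  have [al [A A0 aA]] := (bounded_operatorP _).1 ab.
  have [bl [B B0 bB]] := (bounded_operatorP _).1 bb.
  split; split; try exact: bounded_operator_comp.
  + move=> e e0.
    have [d d0 dB] := small_part B0 e0.
    have [s sa] := aC _ d0.
    have [d' d'0 d'K] := small_part (coef_norm_ge0 s) e0.
    have [t [tb ts]] := bI _ d'0.
    exists (mul_seq s t); split.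
      have -> : a \o b - lreg (mul_seq s t) =
          (a - lreg s) \o b + (lreg s \o (b - lreg t)).
        rewrite lreg_mul; apply/funext => xi.
        rewrite [LHS](_ : _ = a (b xi) - lreg s (lreg t xi))//.
        rewrite [RHS](_ : _ = a (b xi) - lreg s (b xi) +
          lreg s (b xi - lreg t xi))//.
        by rewrite (linearB_op _ _ (lreg_linear s)) subrKA.
      rewrite (splitr e); apply: op_boundD.
        by apply: op_boundW dB _; apply: op_bound_comp => //; exact: ltW.
      rewrite mulrC in d'K; apply: op_boundW d'K _.
      by apply: op_bound_comp (op_bound_lreg s) tb; exact: coef_norm_ge0.
    apply: (small_translate_sumsW _ (@small_translate_sums_mull _ _ _ ts)).
    by rewrite mulrC; lra.
  + move=> e e0.
    have [d d0 dB] := small_part B0 e0.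
    have [s sa] := aC _ d0.
    have [d' d'0 d'K] := small_part (coef_norm_ge0 s) e0.
    have [t [tb ts]] := bI _ d'0.
    exists (mul_seq t s); split.
      have -> : b \o a - lreg (mul_seq t s) =
          b \o (a - lreg s) + ((b - lreg t) \o lreg s).
        rewrite lreg_mul; apply/funext => xi.
        rewrite [LHS](_ : _ = b (a xi) - lreg t (lreg s xi))//.
        rewrite [RHS](_ : _ = b (a xi - lreg s xi) +
          (b (lreg s xi) - lreg t (lreg s xi)))//.
        by rewrite (linearB_op _ _ bl) subrKA.
      rewrite (splitr e); apply: op_boundD.
        by rewrite mulrC in dB; apply: op_boundW dB _; exact: op_bound_comp.
      apply: op_boundW d'K _; apply: op_bound_comp tb (op_bound_lreg s).
      exact: ltW.
    apply: (small_translate_sumsW _ (@small_translate_sums_mulr _ _ _ ts)).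
    by rewrite mulrC; lra.
- move=> a [ab aI]; split=> // e e0.
  have e20 : 0 < e / 2 by rewrite divr_gt0.
  have [b [bb bI] ba] := aI _ e20; have [s [sb ss]] := bI _ e20.
  exists s; split; last by apply: small_translate_sumsW ss; lra.
  rewrite (splitr e) -(subrKA b); apply: op_boundD => //.
  exact: opnormB_lt_op_bound.
Qed.

End coset_ideal.
(** * Amenable subgroups and the reduced norm *)

Section weak_containment.
Variables (R : realType) (G : groupType) (H : set G) (m : (G -> R) -> R).
Hypotheses (HP : subgroup_set H) (mP : invariant_mean_on H m).
Implicit Types (s : seq (R[i] * G)).

Lemma normc_real (x : R) : normc x%:C%C = `|x|.
Proof. by rewrite /= expr0n addr0 sqrtr_sqr. Qed.

Lemma sqrt_diff_sqr (a b : R) : 0 <= a -> 0 <= b ->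
  (Num.sqrt a - Num.sqrt b) ^+ 2 <= `|a - b|.
Proof.
move=> a0 b0.
have := sqr_sqrtr a0; have := sqr_sqrtr b0.
have := sqrtr_ge0 a; have := sqrtr_ge0 b.
move: (Num.sqrt a) (Num.sqrt b) => x y y0 x0 <- <-.
rewrite subr_sqr normrM -real_normK ?num_real// expr2 ler_wpM2l// ler_norml.
by rewrite ger0_norm ?addr_ge0//; lra.
Qed.

(** The square root of an almost invariant positive function is an almost
invariant vector. *)
Lemma almost_invariant_l2 (hs : seq G) (d : R) : 0 < d ->
  exists xi : l2 R G, [/\ forall x, ~ H x -> xi x = 0, 0 < l2norm xi
    & forall h, h \in hs -> H h ->
        l2norm (left_regular h xi - xi) <= d * l2norm xi].
Proof.
move=> d0; have [H1 _ _] := HP.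
(* Elements of hs outside H are replaced by 1, which moves nothing. *)
pose h (i : 'I_(size hs)) :=
  if `[< H (nth 1%g hs i) >] then nth 1%g hs i else 1%g.
have Hh i : H (h i) by rewrite /h; case: asboolP.
have [|f [[f0 fH] nf inv]] := @almost_invariant_l1 _ _ H m _ h HP mP Hh (d ^+ 2).
  exact: exprn_gt0.
have sq x : normc (Num.sqrt (f x))%:C%C ^+ 2 = `|f x|.
  by rewrite normc_real ger0_norm ?sqrtr_ge0// sqr_sqrtr// ger0_norm.
have xi_l2 : (fun x => (Num.sqrt (f x))%:C%C) \in @l2_pred R G.
  by apply/l2_predP; under eq_esum do rewrite sq; exact: l1P.
pose xi := L2 xi_l2.
have nxi : l2norm xi ^+ 2 = l1norm f.
  by rewrite sqr_l2norm; congr total; apply/funext => x; exact: sq.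
exists xi; split=> [x Hx| |g ghs Hg].
- by rewrite /= fH// sqrtr0.
- by rewrite lt_def l2norm_ge0 andbT -sqrf_eq0 nxi gt_eqF.
- rewrite -ler_sqr ?nnegrE ?l2norm_ge0 ?mulr_ge0 ?l2norm_ge0 ?(ltW d0)//.
  rewrite exprMn nxi; apply: le_trans (ltW inv); rewrite sqr_l2norm.
  have ig : (index g hs < size hs)%N by rewrite index_mem.
  have hg : h (Ordinal ig) = g by rewrite /h /= nth_index// asboolT.
  rewrite /family_norm (bigD1 (Ordinal ig))//=.
  apply: (@le_trans _ _ (l1norm (boundary h f (Ordinal ig)))); last first.
    by rewrite lerDl sumr_ge0// => j _; exact: l1norm_ge0.
  rewrite /boundary hg.
  apply: total_le => [x|x|]; [exact: sqr_ge0| |exact: l1P].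
  rewrite subrr expr0n addr0 sqrtr_sqr real_normK ?num_real//.
  exact: sqrt_diff_sqr.
Qed.

Lemma l2_sumE (I : Type) (r : seq I) (P : pred I) (F : I -> l2 R G) x :
  (\sum_(i <- r | P i) F i) x = \sum_(i <- r | P i) F i x.
Proof. by apply: (big_morph (fun u : l2 R G => u x)). Qed.

(** The trivial character of the amenable group H, extended by 0, is a limit
of vector states of the left regular representation. For xi supported in H,
the terms of lreg s xi that come from H live on H and the others live off H;
so the former, which nearly add up to coef_sum H s *: xi, have at most the
norm of the whole sum. *)
Lemma coef_sum_le_norm s (C : R) : op_bound (@lreg R G s) C ->
  normc (coef_sum H s) <= C.
Proof.
move=> sC; apply/ler_addgt0Pl => e e0; rewrite addrC; have [H1 HM HV] := HP.
have [d d0 ds] := small_part (coef_norm_ge0 s) e0.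
have [xi [xiH nxi inv]] := almost_invariant_l2 [seq p.2 | p <- s] d0.
rewrite -(ler_pM2r nxi) -l2normZ mulrDl.
pose eta := \sum_(p <- s | `[< H p.2 >]) p.1 *: left_regular p.2 xi.
pose err := \sum_(p <- s | `[< H p.2 >]) p.1 *: (left_regular p.2 xi - xi).
have -> : coef_sum H s *: xi = eta - err.
  rewrite /eta /err -sumrB scaler_suml; apply: eq_bigr => p _.
  by rewrite -scalerBr subKr.
apply: le_trans (l2normD _ _) _; rewrite l2normN; apply: lerD.
  apply: le_trans (sC xi); apply: l2norm_le => x; rewrite lregE !l2_sumE.
  have [Hx|Hx] := pselect (H x).
    rewrite [leLHS](_ : _ = normc (\sum_(p <- s) (p.1 *: left_regular p.2 xi) x))//.
    rewrite big_mkcond; congr normc; apply: eq_bigr => p _.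
    case: asboolP => // Hp; rewrite [RHS](_ : _ = p.1 * xi (p.2^-1 * x)%g)//.
    rewrite xiH ?mulr0// => Hpx; apply: Hp.
    have := HM _ _ Hx (HV _ Hpx); rewrite invgM invgK mulVKg //.
  rewrite big1 ?normc0 ?normc_ge0// => p /asboolP Hp.
  rewrite [LHS](_ : _ = p.1 * xi (p.2^-1 * x)%g)// xiH ?mulr0// => Hpx.
  by apply: Hx; rewrite -(mulVKg p.2 x); exact: HM.
apply: le_trans (l2norm_sum _ _ _) _.
apply: (@le_trans _ _ (d * coef_norm s * l2norm xi)); last first.
  by apply: ler_wpM2r; [exact: ltW|lra].
rewrite mulrAC mulr_sumr big_mkcond /= big_seq [leRHS]big_seq.
apply: ler_sum => p ps.
case: asboolP => [Hp|_].
  rewrite l2normZ mulrC ler_wpM2r ?normc_ge0// inv//.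
  by apply/mapP; exists p.
by rewrite !mulr_ge0 ?normc_ge0 ?ltW.
Qed.

Lemma coset_ideal_coef_sum s : coset_ideal H (@lreg R G s) -> coef_sum H s = 0.
Proof.
move=> [_ sI]; apply: eq0_normc; apply/eqP; rewrite eq_le normc_ge0 andbT.
apply/ler_addgt0Pl => e e0; rewrite addr0.
have [|t [st tt]] := sI (e / 2); first by rewrite divr_gt0.
have -> : coef_sum H s = coef_sum H (s ++ scale_seq (-1) t) + coef_sum H t.
  by rewrite coef_sum_cat coef_sum_scale mulN1r subrK.
rewrite (splitr e); apply: le_trans (normcD _ _) _; apply: lerD.
  by apply: coef_sum_le_norm; rewrite lreg_cat lreg_scale scaleN1r.
have := tt 1%g 1%g; rewrite /translate_sum.
by under [X in coef_sum X]eq_set do rewrite mulg1 mul1g.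
Qed.

End weak_containment.
(** * Groups with infinitely many disjointly supported elements *)

Section disjoint_supports.
Variables (R : realType) (G : groupType) (X : eqType) (act : G -> X -> X).
Hypothesis actM : forall g h x, act (g * h)%g x = act g (act h x).
Hypothesis act1 : forall x, act 1%g x = x.
Hypothesis act_faithful : forall g h, (forall x, act g x = act h x) -> g = h.
Variables (b : nat -> G) (p : nat -> X).
Hypothesis b_disjoint :
  forall i j x, act (b i) x <> x -> act (b j) x <> x -> i = j.
Hypothesis b_moves : forall i, act (b i) (p i) <> p i.

Definition stab (A : seq X) : set G := [set g | forall x, x \in A -> act g x = x].

Lemma actK g : cancel (act g) (act g^-1%g).
Proof. by move=> x; rewrite -actM mulVg act1. Qed.

Lemma stab_subgroup A : subgroup_set (stab A).
Proof.
split=> [x _|g h gA hA x xA|g gA x xA]; first exact: act1.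
  by rewrite actM hA// gA.
by rewrite -[in LHS](gA x xA) actK.
Qed.

Lemma b_fix_moved i j x : act (b j) x <> x -> i <> j -> act (b i) x = x.
Proof. by move=> bx ij; apply: contrapT => bix; exact/ij/(b_disjoint bix). Qed.

Lemma b_fix_image i j x : act (b j) x <> x -> i <> j ->
  act (b i) (act (b j) x) = act (b j) x.
Proof. by move=> bx; apply: b_fix_moved => /(can_inj (actK _)). Qed.

Lemma b_commute i j : i <> j -> (b i * b j)%g = (b j * b i)%g.
Proof.
move=> ij; apply: act_faithful => x; rewrite !actM.
have [bjx|bjx] := pselect (act (b j) x = x); last first.
  by rewrite b_fix_image// (b_fix_moved bjx ij).
rewrite bjx; have [->|bix] := pselect (act (b i) x = x); first by rewrite bjx.
by rewrite b_fix_image// => ji; apply: ij.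
Qed.

(** The product of the elements 1 - b i of the group algebra, i < N. *)
Fixpoint alt (N : nat) : seq (R[i] * G) :=
  if N is N'.+1 then mul_seq (alt N') [:: (1, 1%g); (-1, b N')]
  else [:: (1, 1%g)].

Lemma coef_sum_altS (Q : set G) N : coef_sum Q (alt N.+1) =
  coef_sum Q (alt N) - coef_sum [set k | Q (k * b N)%g] (alt N).
Proof.
rewrite /= coef_sum_mulr !big_cons big_nil /= addr0 mul1r mulN1r.
by congr (coef_sum _ _ - _); apply/seteqP; split=> k /=; rewrite mulg1.
Qed.

(** The factor 1 - b i can be moved to the right end, where Q does not see the
difference between 1 and b i. *)
Lemma coef_sum_alt_invariant (Q : set G) i N : (i < N)%N ->
  (forall k, Q (k * b i)%g <-> Q k) -> coef_sum Q (alt N) = 0.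
Proof.
elim: N Q => // N IHN Q; rewrite ltnS leq_eqVlt coef_sum_altS.
have [<- _ Qi|iN /= ltiN Qi] := eqVneq i N.
  rewrite (_ : [set k | _] = Q) ?subrr//.
  by apply/seteqP; split=> k /Qi.
rewrite !IHN ?subrr// => k /=.
by rewrite -mulgA b_commute ?mulgA//; apply/eqP.
Qed.

(** The translates by v of the points of A are fewer than the disjoint supports
of the b i, so one of these supports avoids them all. *)
Lemma translate_sum_alt (A : seq X) N u v : (size A < N)%N ->
  translate_sum (stab A) (alt N) u v = 0.
Proof.
move=> AN.
have [i iN biA] : exists2 i, (i < N)%N &
    forall x, x \in A -> act (b i) (act v x) = act v x.
  apply: contrapT => noi.
  have /choice[f fP] : forall i : 'I_N, exists k : 'I_(size A),
      act (b i) (act v (tnth (in_tuple A) k)) <> act v (tnth (in_tuple A) k).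
    move=> i; apply: contrapT => nok; apply: noi; exists i => // x.
    move=> /(tnthP (in_tuple A))[k ->].
    by apply: contrapT => bk; apply: nok; exists k.
  have : (#|'I_N| <= #|'I_(size A)|)%N.
    apply: (@leq_card _ _ f) => i j fij; apply: val_inj.
    by apply: (b_disjoint (fP i)); rewrite fij; exact: fP.
  by rewrite !card_ord leqNgt AN.
apply: (coef_sum_alt_invariant iN) => k /=.
split=> kA x xA; have := kA x xA; rewrite !actM biA//.
Qed.

Lemma alt_fix N x : (forall i, (i < N)%N -> act (b i) x = x) ->
  forall q, q \in alt N -> act q.2 x = x.
Proof.
elim: N => [|N IHN] bx q /=.
  by rewrite inE => /eqP ->; rewrite act1.
have IH := IHN (fun i iN => bx i (ltnW iN)).
move=> /allpairsP[[r t] /= [/IH rx tN ->]] /=; rewrite actM.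
suff -> : act t.2 x = x by [].
by move: tN; rewrite !inE => /orP[/eqP->|/eqP->] /=; rewrite ?act1 ?bx.
Qed.

(** A term of the product other than 1 has a last factor b i, and it moves p i:
the image of p i under b i is still in the support of b i, so the other factors
fix it. *)
Lemma coef_sum_alt (A : seq X) N : (forall i, (i < N)%N -> p i \in A) ->
  coef_sum (stab A) (alt N) = 1.
Proof.
elim: N => [_|N IHN pA].
  by rewrite /coef_sum big_cons big_nil asboolT ?addr0//=;
    have [] := stab_subgroup A.
rewrite coef_sum_altS IHN => [|i iN]; last by apply: pA; exact: ltnW.
rewrite [X in _ - X](_ : _ = 0) ?subr0// /coef_sum big_seq_cond big1// => q.
move=> /andP[qN /asboolP qA]; have := qA _ (pA _ (ltnSn N)).
rewrite actM (alt_fix _ qN); first by move=> /b_moves.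
move=> i iN; apply: b_fix_image; first exact: b_moves.
by move=> iN'; rewrite iN' ltnn in iN.
Qed.

Variable x0 : X.
Hypothesis stab_mean : forall A, x0 \in A ->
  exists m : (G -> R) -> R, invariant_mean_on (stab A) m.

Lemma infinitely_many_closed_ideals :
  infinite_set [set I : set (l2 R G -> l2 R G) | closed_ideal I].
Proof.
(* A n has 2 n + 1 points, fewer than the 2 k factors of alt k.*2 for k > n. *)
pose A n := x0 :: [seq p i | i <- iota 0 n.*2].
pose I n : set (l2 R G -> l2 R G) := coset_ideal (stab (A n)).
have sA n : size (A n) = n.*2.+1 by rewrite /= size_map size_iota.
have pA n i : (i < n.*2)%N -> p i \in A n.
  by move=> iN; rewrite inE map_f ?orbT// mem_iota.
have inI n k : (n < k)%N -> I n (@lreg R G (alt k.*2)).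
  move=> nk; split=> [|e e0]; first exact: bounded_lreg.
  exists (alt k.*2); split=> [xi|u v].
    rewrite subrr [X in l2norm X](_ : _ = 0)// l2norm0.
    by rewrite mulr_ge0 ?l2norm_ge0 ?ltW.
  rewrite translate_sum_alt ?normc0 ?ltW// sA.
  by rewrite -doubleS leq_double.
have notinI n : ~ I n (@lreg R G (alt n.*2)).
  have [m mP] := stab_mean (mem_head x0 _ : x0 \in A n).
  move=> /(coset_ideal_coef_sum (stab_subgroup _) mP) /eqP.
  by rewrite coef_sum_alt ?oner_eq0//; exact: pA.
have I_neq n k : (n < k)%N -> I n <> I k.
  by move=> nk Ink; apply: (notinI k); rewrite -Ink; exact: inI.
have I_inj : injective I.
  move=> n k Ink; have [nk|kn|//] := ltngtP n k; first by have := I_neq _ _ nk.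
  by have := I_neq _ _ kn; rewrite Ink.
move=> /(finite_preimage (f := I)) fin; apply: infinite_nat.
apply: sub_finite_set (fin _); last by move=> n k _ _; exact: I_inj.
by move=> n _; exact: coset_ideal_closed_ideal.
Qed.

End disjoint_supports.
(** * Elements of T supported on small arcs *)

Section lift_map.
Variable R : realType.
Implicit Types (q : R -> R) (t x y : R).

Definition frac x : R := x - (Num.floor x)%:~R.

Lemma frac_itv x : 0 <= frac x < 1.
Proof.
have /andP[] := floor_itv x; rewrite /frac intrD.
by move: (_%:~R) => n; lra.
Qed.

Lemma cpi_frac x : cpi (frac x) = cpi x.
Proof. by apply/cpiP; rewrite /frac addrAC subrr sub0r rpredN intr_int. Qed.

Definition lift_map q (c : circle R) : circle R := cpi (q (frac (repr c))).

Lemma circle_frac (c : circle R) : exists2 t, 0 <= t < 1 & c = cpi t.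
Proof.
exists (frac (repr c)); first exact: frac_itv.
by rewrite cpi_frac /cpi reprK.
Qed.

(** As q is the identity on the nonpositive reals and beyond 1/2, the formula
holds on more than the fundamental domain [0, 1), in particular around 0; this
is what local properties at the point 0 of the circle need. *)
Lemma lift_mapE q t : (forall x, x <= 0 -> q x = x) ->
    (forall x, 2^-1 <= x -> q x = x) -> - 2^-1 <= t <= 1 ->
  lift_map q (cpi t) = cpi (q t).
Proof.
move=> q0 q1 /andP[t0 t1]; rewrite /lift_map.
set r := frac _; have /andP[r0 r1] : 0 <= r < 1 by exact: frac_itv.
have rt : cpi r = cpi t by rewrite /r cpi_frac /cpi reprK.
have /cpiP/intrP[k rk] := rt.
have k1 : (-2 < k)%R by rewrite -(ltr_int R) -rk; lra.
have k2 : (k < 2)%R by rewrite -(ltr_int R) -rk; lra.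
have : k = 0 \/ k = 1 \/ k = -1 by move: k1 k2; clear; lia.
case=> [k0|[k0|k0]]; rewrite k0 /= in rk.
- by congr (cpi (q _)); move: rk; rewrite mulr0z; lra.
- by move: rk; rewrite mulr1z => rk; rewrite q1 ?q0//; lra.
- move: rk; rewrite mulrN1z => rk.
  by rewrite q0 ?[in RHS]q1//; lra.
Qed.

Lemma cpi_inj x y : 0 <= x < 1 -> 0 <= y < 1 -> cpi x = cpi y -> x = y.
Proof.
move=> /andP[x0 x1] /andP[y0 y1] /cpiP/intrP[k xy].
have k1 : (-1 < k)%R by rewrite -(ltr_int R) -xy; lra.
have k2 : (k < 1)%R by rewrite -(ltr_int R) -xy; lra.
have k0 : k = 0 by move: k1 k2; clear; lia.
by move: xy; rewrite k0 mulr0z; lra.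
Qed.

Lemma lift_map_near q x : (forall y, y <= 0 -> q y = y) ->
    (forall y, 2^-1 <= y -> q y = y) ->
  \forall t \near x, lift_map q (cpi t) = cpi (q (t - (Num.floor x)%:~R)).
Proof.
move=> q0 q1; have /andP[x0 x1] := frac_itv x; rewrite /frac in x0 x1.
near=> t.
rewrite -lift_mapE//.
  by congr lift_map; apply/cpiP; rewrite subKr intr_int.
apply/andP; split.
  rewrite lerBrDl ltW//; near: t; apply: lt_nbhsr; lra.
rewrite lerBlDr ltW//; near: t; apply: lt_nbhsl; lra.
Unshelve. all: by end_near. Qed.

Lemma lift_map_continuous q : continuous q -> (forall x, x <= 0 -> q x = x) ->
  (forall x, 2^-1 <= x -> q x = x) -> continuous (lift_map q).
Proof.
move=> qc q0 q1; apply/quotient_continuous => x.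
have e := lift_map_near x q0 q1; set n := (Num.floor x)%:~R : R in e.
have c : cpi (q (t - n)) @[t --> x] --> cpi (q (x - n)).
  apply: (@continuous_comp _ _ _ (fun t => q (t - n)) (@cpi R)).
    apply: (@continuous_comp _ _ _ (fun t => t - n) q); last exact: qc.
    by apply: cvgB; [exact: cvg_id|exact: cvg_cst].
  exact: pi_continuous.
change (lift_map q (cpi t) @[t --> x] --> lift_map q (cpi x)).
rewrite (nbhs_singleton e); apply: cvg_trans c; apply: near_eq_cvg.
by apply: filterS e => t et; rewrite -et.
Qed.

Lemma lift_map_cancel q r : cancel q r -> (forall t, 0 <= t < 1 -> 0 <= q t < 1) ->
    (forall x, x <= 0 -> r x = x) -> (forall x, 2^-1 <= x -> r x = x) ->
    (forall x, x <= 0 -> q x = x) -> (forall x, 2^-1 <= x -> q x = x) ->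
  cancel (lift_map q) (lift_map r).
Proof.
move=> qK q01 r0 r1 q0 q1 c; have [t t01 ->] := circle_frac c.
have /andP[qt0 qt1] := q01 _ t01; have /andP[t0 t1] := t01.
rewrite (lift_mapE q0 q1); last lra.
by rewrite (lift_mapE r0 r1) ?qK//; lra.
Qed.

Lemma lift_map_thompsonT q r (B : seq R) :
    cancel q r -> cancel r q -> continuous q -> continuous r ->
    (forall t, 0 <= t < 1 -> 0 <= q t < 1) ->
    (forall t, 0 <= t < 1 -> 0 <= r t < 1) ->
    (forall x, x <= 0 -> q x = x) -> (forall x, 2^-1 <= x -> q x = x) ->
    (forall x, x <= 0 -> r x = x) -> (forall x, 2^-1 <= x -> r x = x) ->
    (forall x, dyadic x -> dyadic (q x)) -> (forall x, x \in B -> dyadic x) ->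
    (forall x, x \notin B -> exists (k : int) (y : R),
       \forall t \near x, q t = y + 2 ^ k * (t - x)) ->
  lift_map q \in @thompsonT_pred R.
Proof.
move=> qK rK qc rc q01 r01 q0 q1 r0 r1 qd Bd qB; apply/asboolP; split.
- by exists (lift_map r); split;
    [exact: lift_map_cancel|exact: lift_map_cancel|
     exact: lift_map_continuous|exact: lift_map_continuous].
- exists (@cpi R @` [set` B]); split.
  + exact/finite_image/finite_seq.
  + by move=> _ [x /Bd xd <-]; exact/dyadic_pointsP.
  + move=> x xB; set n := (Num.floor x)%:~R : R.
    have [|k [y qy]] := qB (x - n).
      by apply/negP => xnB; apply: xB; exists (x - n) => //; exact: cpi_frac.
    exists k, y; have e := lift_map_near x q0 q1; rewrite -/n in e.
    have : (fun t => t - n) t @[t --> x] --> x - n.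
      by apply: cvgB; [exact: cvg_id|exact: cvg_cst].
    move=> /(_ _ qy) qy'; near=> t.
    rewrite (near e t)//; congr cpi.
    have -> : q (t - n) = y + 2 ^ k * (t - n - (x - n)) by near: t.
    by congr (_ + _ * _); lra.
- move=> c cd; have [t /andP[t0 t1] ct] := circle_frac c.
  rewrite ct lift_mapE//; last lra.
  by apply/dyadic_pointsP/qd/dyadic_pointsP; rewrite -ct.
Unshelve. all: by end_near. Qed.

End lift_map.

Section bump.
Variable R : realType.
Implicit Types (a t x : R).

(** The standard generator x_0 of F, transported from [0, 1] to [a, 2 a]: its
slopes are 1/2, 1, 2, with breaks at 3 a / 2 and 7 a / 4. As it is convex
there, it is a maximum of affine functions, and lies below the diagonal
exactly on its support. *)
Definition bump a x : R :=
  Num.min x (Num.max ((x + a) / 2) (Num.max (x - a / 4) (2 * x - 2 * a))).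

Definition bump_inv a x : R :=
  Num.max x (Num.min (2 * x - a) (Num.min (x + a / 4) (x / 2 + a))).

Lemma bumpP a x : 0 < a ->
  [\/ (x <= a \/ 2 * a <= x) /\ bump a x = x,
      a <= x <= 3 * a / 2 /\ bump a x = (x + a) / 2,
      3 * a / 2 <= x <= 7 * a / 4 /\ bump a x = x - a / 4
    | 7 * a / 4 <= x <= 2 * a /\ bump a x = 2 * x - 2 * a].
Proof.
move=> a0; have [xa|ax] := leP x a.
  apply: Or41; split; [by left|].
  by rewrite /bump min_l// le_max; apply/orP; left; lra.
have [x1|x1] := leP x (3 * a / 2).
  apply: Or42; split; [by lra|].
  by rewrite /bump max_l ?min_r// ?ge_max; lra.
have [x2|x2] := leP x (7 * a / 4).
  apply: Or43; split; [by lra|].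
  by rewrite /bump (max_l (y := 2 * x - 2 * a)) ?max_r ?min_r//; lra.
have [x3|x3] := leP x (2 * a).
  apply: Or44; split; [by lra|].
  by rewrite /bump (max_r (y := 2 * x - 2 * a)) ?max_r ?min_r//; lra.
apply: Or41; split; [by right; lra|].
by rewrite /bump min_l// !le_max; apply/orP; right; apply/orP; right; lra.
Qed.

Lemma bump_invP a x : 0 < a ->
  [\/ (x <= a \/ 2 * a <= x) /\ bump_inv a x = x,
      a <= x <= 5 * a / 4 /\ bump_inv a x = 2 * x - a,
      5 * a / 4 <= x <= 3 * a / 2 /\ bump_inv a x = x + a / 4
    | 3 * a / 2 <= x <= 2 * a /\ bump_inv a x = x / 2 + a].
Proof.
move=> a0; have [xa|ax] := leP x a.
  apply: Or41; split; [by left|].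
  by rewrite /bump_inv max_l// ge_min; apply/orP; left; lra.
have [x1|x1] := leP x (5 * a / 4).
  apply: Or42; split; [by lra|].
  by rewrite /bump_inv min_l ?max_r// ?le_min; lra.
have [x2|x2] := leP x (3 * a / 2).
  apply: Or43; split; [by lra|].
  by rewrite /bump_inv (min_l (y := x / 2 + a)) ?min_r ?max_r//; lra.
have [x3|x3] := leP x (2 * a).
  apply: Or44; split; [by lra|].
  by rewrite /bump_inv (min_r (y := x / 2 + a)) ?min_r ?max_r//; lra.
apply: Or41; split; [by right; lra|].
by rewrite /bump_inv max_l// !ge_min; apply/orP; right; apply/orP; right; lra.
Qed.

Lemma bumpK a : 0 < a -> cancel (bump a) (bump_inv a).
Proof.
move=> a0 x; have := bump_invP (bump a x) a0; have := bumpP x a0.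
by move: (bump a x) => y; case=> -[? ->]; case=> -[? ->]; lra.
Qed.

Lemma bump_invK a : 0 < a -> cancel (bump_inv a) (bump a).
Proof.
move=> a0 x; have := bumpP (bump_inv a x) a0; have := bump_invP x a0.
by move: (bump_inv a x) => y; case=> -[? ->]; case=> -[? ->]; lra.
Qed.

Lemma continuous_affine (c d : R) : continuous (fun x : R => c * x + d).
Proof.
move=> x; apply: cvgD; last exact: cvg_cst.
by apply: cvgM; [exact: cvg_cst|exact: cvg_id].
Qed.

Lemma bump_continuous a : continuous (bump a).
Proof.
have -> : bump a = (fun x : R => 1 * x + 0) \min ((fun x => 2^-1 * x + a / 2) \max
    ((fun x => 1 * x + - (a / 4)) \max (fun x => 2 * x + - (2 * a)))).
  apply/funext => x; rewrite /bump /=.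
  by congr (Num.min _ (Num.max _ (Num.max _ _))); lra.
move=> x; apply: continuous_min; first exact: continuous_affine.
by apply: continuous_max; [|apply: continuous_max]; exact: continuous_affine.
Qed.

Lemma bump_inv_continuous a : continuous (bump_inv a).
Proof.
have -> : bump_inv a = (fun x : R => 1 * x + 0) \max ((fun x => 2 * x + - a) \min
    ((fun x => 1 * x + a / 4) \min (fun x => 2^-1 * x + a))).
  apply/funext => x; rewrite /bump_inv /=.
  by congr (Num.max _ (Num.min _ (Num.min _ _))); lra.
move=> x; apply: continuous_max; first exact: continuous_affine.
by apply: continuous_min; [|apply: continuous_min]; exact: continuous_affine.
Qed.

Lemma dyadic_half x : dyadic x -> dyadic (x / 2).
Proof. by move=> /(dyadicZ (-1)); rewrite mulrC. Qed.

Lemma dyadic_double x : dyadic x -> dyadic (2 * x).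
Proof. by move=> /(dyadicZ 1); rewrite expr1z. Qed.

Lemma dyadic_bump a x : 0 < a -> dyadic a -> dyadic x -> dyadic (bump a x).
Proof.
move=> a0 ad xd; case: (bumpP x a0) => -[_ ->] //.
- exact/dyadic_half/dyadicD.
- rewrite (_ : x - a / 4 = x - a / 2 / 2); last lra.
  by apply: dyadicD => //; exact/dyadicN/dyadic_half/dyadic_half.
- by apply: dyadicD; [|apply: dyadicN]; exact: dyadic_double.
Qed.

Definition bump_breaks a := [:: a; 3 * a / 2; 7 * a / 4; 2 * a].

Lemma dyadic_bump_breaks a x : dyadic a -> x \in bump_breaks a -> dyadic x.
Proof.
move=> ad; have hd := dyadic_half ad; have qd := dyadic_half hd.
rewrite !inE => /or4P[]/eqP->//.
- by rewrite (_ : 3 * a / 2 = a + a / 2); [exact: dyadicD|lra].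
- rewrite (_ : 7 * a / 4 = a + a / 2 + a / 2 / 2); last lra.
  by apply: dyadicD => //; exact: dyadicD.
- exact: dyadic_double.
Qed.

Lemma bump_affine a x : 0 < a -> x \notin bump_breaks a ->
  exists (k : int) (y : R), \forall t \near x, bump a t = y + 2 ^ k * (t - x).
Proof.
move=> a0; rewrite !inE !negb_or => /and4P[xa x1 x2 x3].
have [{}xa|{}xa|/eqP] := ltgtP x a; last by rewrite (negPf xa).
  exists 0, x; near=> t; have ta : t < a by near: t; exact: lt_nbhsl.
  by rewrite expr0z; case: (bumpP t a0) => -[? ->]; lra.
have [{}x1|{}x1|/eqP] := ltgtP x (3 * a / 2); last by rewrite (negPf x1).
  exists (-1), ((x + a) / 2); near=> t.
  have at0 : a < t by near: t; exact: lt_nbhsr.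
  have ta : t < 3 * a / 2 by near: t; exact: lt_nbhsl.
  by rewrite exprN1; case: (bumpP t a0) => -[? ->]; lra.
have [{}x2|{}x2|/eqP] := ltgtP x (7 * a / 4); last by rewrite (negPf x2).
  exists 0, (x - a / 4); near=> t.
  have at0 : 3 * a / 2 < t by near: t; exact: lt_nbhsr.
  have ta : t < 7 * a / 4 by near: t; exact: lt_nbhsl.
  by rewrite expr0z; case: (bumpP t a0) => -[? ->]; lra.
have [{}x3|{}x3|/eqP] := ltgtP x (2 * a); last by rewrite (negPf x3).
  exists 1, (2 * x - 2 * a); near=> t.
  have at0 : 7 * a / 4 < t by near: t; exact: lt_nbhsr.
  have ta : t < 2 * a by near: t; exact: lt_nbhsl.
  by rewrite expr1z; case: (bumpP t a0) => -[? ->]; lra.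
exists 0, x; near=> t; have ta : 2 * a < t by near: t; exact: lt_nbhsr.
by rewrite expr0z; case: (bumpP t a0) => -[? ->]; lra.
Unshelve. all: by end_near. Qed.

Lemma bump_map_thompsonT a : 0 < a -> a <= 4^-1 -> dyadic a ->
  lift_map (bump a) \in @thompsonT_pred R.
Proof.
move=> a0 a4 ad.
apply: (@lift_map_thompsonT _ _ (bump_inv a) (bump_breaks a)).
- exact: bumpK.
- exact: bump_invK.
- exact: bump_continuous.
- exact: bump_inv_continuous.
- by move=> t t01; case: (bumpP t a0) => -[? ->]; lra.
- by move=> t t01; case: (bump_invP t a0) => -[? ->]; lra.
- by move=> t t0; case: (bumpP t a0) => -[? ->]; lra.
- by move=> t t1; case: (bumpP t a0) => -[? ->]; lra.
- by move=> t t0; case: (bump_invP t a0) => -[? ->]; lra.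
- by move=> t t1; case: (bump_invP t a0) => -[? ->]; lra.
- by move=> x; exact: dyadic_bump.
- by move=> x; exact: dyadic_bump_breaks.
- by move=> x; exact: bump_affine.
Qed.

Lemma bump_map_support a t : 0 < a -> a <= 4^-1 -> 0 <= t < 1 ->
  lift_map (bump a) (cpi t) <> cpi t -> a < t < 2 * a.
Proof.
move=> a0 a4 t01; rewrite lift_mapE; last lra.
- by case: (bumpP t a0) => -[? ->] // ne; apply/andP; split; rewrite lt_neqAle;
    apply/andP; split; try lra; apply/eqP => ta; apply: ne; congr cpi; lra.
- by move=> x x0; case: (bumpP x a0) => -[? ->]; lra.
- by move=> x x1; case: (bumpP x a0) => -[? ->]; lra.
Qed.

Lemma bump_map_moves a : 0 < a -> a <= 4^-1 ->
  lift_map (bump a) (cpi (3 * a / 2)) <> cpi (3 * a / 2).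
Proof.
move=> a0 a4; rewrite lift_mapE; last lra.
- by move=> /cpi_inj; case: (bumpP (3 * a / 2) a0) => -[? ->] => H; have := H; lra.
- by move=> x x0; case: (bumpP x a0) => -[? ->]; lra.
- by move=> x x1; case: (bumpP x a0) => -[? ->]; lra.
Qed.

End bump.
(** * Ideals of the reduced C*-algebra of T *)

Section thompson.
Variable R : realType.

Definition scale_pt (i : nat) : R := (2 ^+ i.+2)^-1.

Lemma scale_pt_gt0 i : 0 < scale_pt i.
Proof. by rewrite invr_gt0 exprn_gt0. Qed.

Lemma scale_pt_double i j : (i < j)%N -> 2 * scale_pt j <= scale_pt i.
Proof.
move=> ij; rewrite /scale_pt exprS invfM mulVKf ?pnatr_eq0//.
by rewrite lef_pV2 ?posrE ?exprn_gt0// ler_weXn2l ?ler1n// ltnS.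
Qed.

Lemma scale_pt_le i : scale_pt i <= 4^-1.
Proof.
rewrite /scale_pt lef_pV2 ?posrE ?exprn_gt0//.
by rewrite (_ : 4 = 2 ^+ 2) ?ler_weXn2l ?ler1n// -natrX.
Qed.

Lemma dyadic_scale_pt i : dyadic (scale_pt i).
Proof. by exists 1, i.+2; rewrite mul1r. Qed.

(** The supports are the disjoint arcs from 2^-(i+2) to 2^-(i+1). *)
Definition dyadic_bump_map (i : nat) : thompsonT R :=
  ThompsonT
    (bump_map_thompsonT (scale_pt_gt0 i) (scale_pt_le i) (dyadic_scale_pt i)).

Lemma dyadic_bump_map_disjoint i j (c : circle R) :
  dyadic_bump_map i c <> c -> dyadic_bump_map j c <> c -> i = j.
Proof.
have [t t01 ->] := circle_frac c.
move=> /(bump_map_support (scale_pt_gt0 i) (scale_pt_le i) t01)/andP[ti it].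
move=> /(bump_map_support (scale_pt_gt0 j) (scale_pt_le j) t01)/andP[tj jt].
by have [/scale_pt_double ?|/scale_pt_double ?|//] := ltngtP i j; exfalso; lra.
Qed.

(** The stabiliser of a finite set that contains 0 is a subgroup of F. *)
Lemma stab_invariant_mean (A : seq (circle R)) : amenable R (thompsonF R) ->
    cpi 0 \in A ->
  exists m : (thompsonT R -> R) -> R,
    invariant_mean_on (stab (@thompsonT_fun R) A) m.
Proof.
move=> Fam A0; apply: (@amenable_subgroup _ _ _ (@thompsonF_val R)) Fam => //.
  exact: stab_subgroup.
move=> g gA; have gF : g \in @thompsonF_pred R by apply/eqP/gA.
by exists (ThompsonF gF).
Qed.

End thompson.

Theorem theorem4p8 (R : realType) :
  amenable R (thompsonF R) ->
  infinite_set
    [set I : set (l2 R (thompsonT R) -> l2 R (thompsonT R)) | closed_ideal I].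
Proof.
move=> Fam.
apply: (@infinitely_many_closed_ideals R (thompsonT R) (circle R)
  (@thompsonT_fun R) _ _ _ (@dyadic_bump_map R)
  (fun i => cpi (3 * scale_pt R i / 2)) _ _ (cpi 0)) => //.
- by move=> g h gh; apply: val_inj; apply/funext.
- exact: dyadic_bump_map_disjoint.
- by move=> i; apply: bump_map_moves; [exact: scale_pt_gt0|exact: scale_pt_le].
- by move=> A; exact: stab_invariant_mean.
Qed.
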